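(* Let $S\in\mathcal S_d(\mathcal U,\mathcal Y)$ with a fixed decomposition $$I_{\mathcal U}-S(z)^*S(\zeta)=\sum_{j=1}^d\Phi_{jj}(z,\zeta)-\sum_{i,\ell=1}^d\overline z_i\zeta_\ell\Phi_{i\ell}(z,\zeta)\qquad(z,\zeta\in\mathbb B^d),\qquad(\ast)$$ where $\Phi=[\Phi_{ij}]_{i,j=1}^d:\mathbb B^d\times\mathbb B^d\to\mathcal L(\mathcal U^d)$ is a positive kernel, and let $\widetilde V$ be the isometric operator associated with it (see context). Then: (1) A block-operator matrix $\mathbf U=\begin{bmatrix}A&B\\ C&D\end{bmatrix}:\mathcal H(\Phi)\oplus\mathcal U\to\mathcal H(\Phi)^d\oplus\mathcal Y$ is a d.c.f.m. colligation for $S$ (associated with $\Phi$) if and only if $\mathbf U$ is a contractive extension of $\widetilde V$ to all of $\mathcal H(\Phi)\oplus\mathcal U$. In particular, a d.c.f.m. colligation for $S$ exists. (2) Every d.c.f.m. colligation $\mathbf U=\begin{bmatrix}A&B\\ C&D\end{bmatrix}$ for $S$ is weakly isometric and controllable, and furthermore $S(z)=D+C(I-Z_{\mathcal H(\Phi)}(z)A)^{-1}Z_{\mathcal H(\Phi)}(z)B$ for $z\in\mathbb B^d$. (3) Any controllable weakly isometric colligation $\widetilde{\mathbf U}=\begin{bmatrix}\widetilde A&\widetilde B\\ \widetilde C&D\end{bmatrix}:\mathcal X\oplus\mathcal U\to\mathcal X^d\oplus\mathcal Y$ with characteristic function equal to $S$ is unitarily equivalent to some d.c.f.m. colligation for $S$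 based on the decomposition $(\ast)$ with $\Phi_{i\ell}$ given by $$\Phi_{i\ell}(z,\zeta)=\widetilde B^*(I-Z_{\mathcal X}(z)^*\widetilde A^* )^{-1}\mathcal I_i\mathcal I_\ell^*(I-\widetilde AZ_{\mathcal X}(\zeta))^{-1}\widetilde B.$$
   Context: All spaces are complex Hilbert spaces; $\bigvee$ denotes closed linear span, $\mathbb B^d$ is the open unit ball of $\mathbb C^d$. $\mathcal S_d(\mathcal U,\mathcal Y)$ is the set of functions $S:\mathbb B^d\to\mathcal L(\mathcal U,\mathcal Y)$ for which the kernel $\frac{I_{\mathcal Y}-S(z)S(\zeta)^*}{1-\langle z,\zeta\rangle}$ is positive on $\mathbb B^d\times\mathbb B^d$. A kernel $K$ with values in $\mathcal L(\mathcal E)$ is positive if $\sum_{i,j}\langle K(z_i,z_j)c_j,c_i\rangle\ge0$ for all finite families; $\mathcal H(K)$ is its reproducing kernel Hilbert space, $\langle f,K(\cdot,\zeta)c\rangle=\langle f(\zeta),c\rangle$. $Z_{\mathcal X}(z)=\begin{bmatrix}z_1I_{\mathcal X}&\cdots&z_dI_{\mathcal X}\end{bmatrix}:\mathcal X^d\to\mathcal X$; $\mathcal I_i:\mathcal X\to\mathcal X^d$ is the inclusion into the $i$-th slot. A colligation is a bounded operator $\mathbf U=\begin{bmatrix}A&B\\ C&D\end{bmatrix}:\mathcal X\oplus\mathcal U\to\mathcal X^d\oplus\mathcal Y$; if contractive, its characteristic function is $D+C(I-Z_{\mathcal X}(z)A)^{-1}Z_{\mathcal X}(z)B$, $z\in\mathbb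 B^d$. It is controllable if $\bigvee\{\mathcal I_j^*(I-AZ_{\mathcal X}(z))^{-1}Bu: z\in\mathbb B^d,u\in\mathcal U,1\le j\le d\}=\mathcal X$. A contractive colligation is weakly isometric if $\mathbf U$ is isometric on $\widetilde{\mathcal D}_{A,B}\oplus\mathcal U$, where $\widetilde{\mathcal D}_{A,B}=\bigvee_{\zeta\in\mathbb B^d,u\in\mathcal U}Z_{\mathcal X}(\zeta)(I-AZ_{\mathcal X}(\zeta))^{-1}Bu$. Colligations $\begin{bmatrix}A&B\\ C&D\end{bmatrix}$ on $\mathcal X$ and $\begin{bmatrix}\widetilde A&\widetilde B\\ \widetilde C&D\end{bmatrix}$ on $\widetilde{\mathcal X}$ are unitarily equivalent if there is a unitary $U:\mathcal X\to\widetilde{\mathcal X}$ with $(\oplus_1^dU)A=\widetilde AU$, $(\oplus_1^dU)B=\widetilde B$, $C=\widetilde CU$. Given $S\in\mathcal S_d(\mathcal U,\mathcal Y)$ and a positive kernel $\Phi$ satisfying $(\ast)$, let $\Phi_{\bullet k}(z,\zeta)$ be the $k$-th block column $\begin{bmatrix}\Phi_{1k}(z,\zeta)\\ \vdots\\ \Phi_{dk}(z,\zeta)\end{bmatrix}$ of $\Phi$, let $\mathbb T(z,\zeta)=\begin{bmatrix}\Phi_{\bullet1}(z,\zeta)\\ \vdots\\ \Phi_{\bullet d}(z,\zeta)\end{bmatrix}$ (so $\mathbb T(\cdot,\zeta)u\in\mathcal H(\Phi)^d$), and let $\widetilde{\mathcal D}=\bigvee\{\sum_{j=1}^d\zeta_j\Phi_{\bullet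 j}(\cdot,\zeta)u:\zeta\in\mathbb B^d,u\in\mathcal U\}\subset\mathcal H(\Phi)$. By $(\ast)$ the map $$\widetilde V:\begin{bmatrix}\sum_{j=1}^d\zeta_j\Phi_{\bullet j}(\cdot,\zeta)u\\ u\end{bmatrix}\mapsto\begin{bmatrix}\mathbb T(\cdot,\zeta)u\\ S(\zeta)u\end{bmatrix}\qquad(\zeta\in\mathbb B^d,\ u\in\mathcal U)$$ extends by linearity and continuity to an isometry from $\widetilde{\mathcal D}\oplus\mathcal U$ into $\mathcal H(\Phi)^d\oplus\mathcal Y$. A contractive block-operator matrix $\begin{bmatrix}A&B\\ C&D\end{bmatrix}:\mathcal H(\Phi)\oplus\mathcal U\to\mathcal H(\Phi)^d\oplus\mathcal Y$ is a dual canonical functional-model (d.c.f.m.) colligation associated with the decomposition $(\ast)$ for $S$ if for all $\zeta\in\mathbb B^d$, $u\in\mathcal U$: $A\big(\sum_j\zeta_j\Phi_{\bullet j}(\cdot,\zeta)u\big)=\mathbb T(\cdot,\zeta)u-\mathbb T(\cdot,0)u$, $C\big(\sum_j\zeta_j\Phi_{\bullet j}(\cdot,\zeta)u\big)=S(\zeta)u-S(0)u$, $Bu=\mathbb T(\cdot,0)u$, $Du=S(0)u$. *)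

(* Defs.v *)
From HB Require Import structures.
From mathcomp Require Import all_boot all_order all_algebra.
From mathcomp Require Import complex.
From mathcomp Require Import boolp classical_sets functions reals.
From mathcomp Require Import topology normedtype.

Set Implicit Arguments.
Unset Strict Implicit.
Unset Printing Implicit Defensive.

Import Order.TTheory GRing.Theory Num.Theory.
Import numFieldNormedType.Exports.

Local Open Scope classical_set_scope.
Local Open Scope ring_scope.

(* The inner product is linear in its first argument. *)
HB.mixin Record CompleteNormedModule_isHilbert (R : realType) (H : Type)
    & CompleteNormedModule R[i] H := {
  inner : H -> H -> R[i];
  innerDl : forall x y z, inner (x + y) z = inner x z + inner y z;
  innerZl : forall a x z, inner (a *: x) z = a * inner x z;
  inner_conj : forall x y, inner y x = (inner x y)^*;
  inner_norm : forall x, inner x x = `|x| ^+ 2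
}.

#[short(type="hilbertType")]
HB.structure Definition Hilbert (R : realType) :=
  { H of CompleteNormedModule R[i] H & CompleteNormedModule_isHilbert R H }.

Notation "'<|' x , y '|>'" := (inner x y)
  (at level 0, x, y at level 99, format "<| x ,  y |>") : ring_scope.

HB.factory Record Lmodule_isHilbert (R : realType) (H : Type)
    & GRing.Lmodule R[i] H := {
  ip : H -> H -> R[i];
  ipDl : forall x y z, ip (x + y) z = ip x z + ip y z;
  ipZl : forall a x z, ip (a *: x) z = a * ip x z;
  ip_conj : forall x y, ip y x = (ip x y)^*;
  ip_ge0 : forall x, 0 <= ip x x;
  ip_eq0 : forall x, ip x x = 0 -> x = 0;
  ip_complete : forall F : set_system H, ProperFilter F ->
    (forall e : R[i], 0 < e ->
       exists x, F [set y | sqrtC (ip (x - y) (x - y)) < e]) ->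
    exists x, forall e : R[i], 0 < e ->
       F [set y | sqrtC (ip (x - y) (x - y)) < e]
}.

HB.builders Context R H & Lmodule_isHilbert R H.

Let nrm (x : H) : R[i] := sqrtC (ip x x).

Let ipDr x y z : ip z (x + y) = ip z x + ip z y.
Proof. by rewrite ip_conj ipDl rmorphD/= -!ip_conj. Qed.

Let ipZr a x z : ip z (a *: x) = a^* * ip z x.
Proof. by rewrite ip_conj ipZl rmorphM/= -ip_conj. Qed.

Let nrm_ge0 x : 0 <= nrm x. Proof. by rewrite sqrtC_ge0 ip_ge0. Qed.

Let nrm2 x : nrm x ^+ 2 = ip x x. Proof. exact: sqrtCK. Qed.

Let nrmZ (a : R[i]) x : nrm (a *: x) = `|a| * nrm x.
Proof.
apply/eqP; rewrite -(@eqrXn2 _ 2%N)// ?mulr_ge0//; apply/eqP.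
by rewrite exprMn !nrm2 ipZl ipZr mulrA normCK.
Qed.

Let nrm_eq0 x : nrm x = 0 -> x = 0.
Proof. by move=> /eqP; rewrite sqrtC_eq0 => /eqP /ip_eq0. Qed.

Let ip0l x : ip 0 x = 0.
Proof. by rewrite -(scale0r 0) ipZl mul0r. Qed.

Let cs x y : `|ip x y| ^+ 2 <= ip x x * ip y y.
Proof.
have [->|y0] := eqVneq y 0.
  by rewrite ip_conj !ip0l conjC0 normr0 expr0n mulr0.
have yy0 : 0 < ip y y.
  by rewrite lt_def ip_ge0 andbT; apply: contra_neq y0; exact: ip_eq0.
have := ip_ge0 (x + (- (ip x y / ip y y)) *: y).
rewrite ipDl !ipDr !ipZl !ipZr.
have yyr : (ip y y)^* = ip y y by rewrite -ip_conj.
rewrite rmorphN fmorph_div/= yyr -(ip_conj x y).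
set d := ip x y; set e := ip y x; set n := ip y y.
have -> : ip x x + - (e / n) * d + (- (d / n) * e + - (d / n) * (- (e / n) * n))
   = ip x x - d * e / n.
  have n0 : n != 0 by rewrite gt_eqF.
  rewrite (mulNr (e / n) n) divfK// mulrNN (mulNr (d / n)) addNr addr0.
  by rewrite mulNr mulrAC (mulrC e d).
rewrite subr_ge0 ler_pdivrMr// /e ip_conj -/d -normCK.
by [].
Qed.

Let nrmD x y : nrm (x + y) <= nrm x + nrm y.
Proof.
rewrite -(@ler_pXn2r _ 2%N)// ?nnegrE ?addr_ge0// sqrrD !nrm2 ipDl !ipDr.
rewrite addrA -(addrA (ip x x)) lerD2r// lerD2l.
rewrite [ip y x]ip_conj.
have csn : `|ip x y| <= nrm x * nrm y.
  rewrite -(@ler_pXn2r _ 2%N)// ?nnegrE ?mulr_ge0//.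
  by rewrite exprMn !nrm2; exact: cs.
apply: (@le_trans _ _ (`|ip x y| *+ 2)); last by rewrite lerMn2r csn orbT.
have hr : ip x y + (ip x y)^* \is Num.real.
  by apply/CrealP; rewrite rmorphD/= conjCK addrC.
apply: le_trans (real_ler_norm hr) _.
by apply: le_trans (ler_normD _ _) _; rewrite norm_conjC mulr2n.
Qed.

HB.instance Definition _ :=
  Lmodule_isNormed.Build R[i] H nrmD nrmZ nrm_eq0.

Let nrm_complete (F : set_system H) : ProperFilter F -> cauchy F -> cvg F.
Proof.
move=> FF /cauchyP Fc; apply/cvg_ex.
have [|x xF] := ip_complete FF.
  by move=> e e0; have [x xF] := Fc _ e0; exists x.
exists x; apply/cvg_ballP => e e0; exact: xF.
Qed.

HB.instance Definition _ := Uniform_isComplete.Build H nrm_complete.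

Let inn x : ip x x = `|x| ^+ 2. Proof. by rewrite -nrm2. Qed.

HB.instance Definition _ :=
  CompleteNormedModule_isHilbert.Build R H ipDl ipZl ip_conj inn.

HB.end.

Section HilbertTheory.
Context {R : realType} {H : hilbertType R}.
Implicit Types x y : H.

Lemma inner_ge0 x : 0 <= <|x, x|>.
Proof. by rewrite inner_norm exprn_ge0. Qed.

Lemma inner_eq0 x : <|x, x|> = 0 -> x = 0.
Proof. by rewrite inner_norm => /eqP; rewrite sqrf_eq0 normr_eq0 => /eqP. Qed.

Lemma sqrtC_inner x : sqrtC <|x, x|> = `|x|.
Proof. by rewrite inner_norm sqrCK. Qed.

Lemma hilbert_complete (F : set_system H) : ProperFilter F ->
  (forall e : R[i], 0 < e -> exists x, F [set y | `|x - y| < e]) ->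
  exists x, forall e : R[i], 0 < e -> F [set y | `|x - y| < e].
Proof.
move=> FF Fc; have cF : cauchy F.
  by apply/cauchyP => e /Fc[x xF]; exists x; rewrite -ball_normE.
have /cvg_ex[x /cvg_ballP xF] := @cauchy_cvg H F FF cF.
by exists x => e /xF; rewrite -ball_normE.
Qed.

End HilbertTheory.

Lemma sqrtC_sum_sqr_le (R : realType) (d : nat) (a : 'I_d -> R[i]) :
  (forall i, 0 <= a i) -> sqrtC (\sum_i a i ^+ 2) <= \sum_i a i.
Proof.
move=> a0; have s0 : 0 <= \sum_i a i by apply: sumr_ge0.
rewrite -[leRHS]sqrCK// ler_sqrtC ?qualifE/= ?exprn_ge0//; last first.
  by apply: sumr_ge0 => i _; rewrite exprn_ge0.
rewrite expr2 mulr_suml; apply: ler_sum => i _.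
by rewrite expr2 ler_wpM2l// (bigD1 i)//= lerDl sumr_ge0.
Qed.

Lemma sqrtC_sqrD_le (R : realType) (a b : R[i]) : 0 <= a -> 0 <= b ->
  sqrtC (a ^+ 2 + b ^+ 2) <= a + b.
Proof.
move=> a0 b0; rewrite -[leRHS]sqrCK ?addr_ge0//.
rewrite ler_sqrtC ?qualifE/= ?addr_ge0 ?exprn_ge0 ?addr_ge0//.
by rewrite sqrrD addrAC lerDl mulrn_wge0// mulr_ge0.
Qed.

(* [X * Y] and [{ffun 'I_d -> X}] are renamed so that the Hilbert norm does not
   compete with the sup norm that the library puts on products. *)
Definition hsum (R : realType) (X Y : hilbertType R) : Type := (X * Y)%type.
Definition hpow (R : realType) (d : nat) (X : hilbertType R) : Type :=
  {ffun 'I_d -> X}.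

Section DirectSum.
Context (R : realType) (X Y : hilbertType R).

HB.instance Definition _ := GRing.Lmodule.copy (hsum X Y) (X * Y)%type.

Let hsumB1 (x y : hsum X Y) : (x - y).1 = x.1 - y.1. Proof. by []. Qed.
Let hsumB2 (x y : hsum X Y) : (x - y).2 = x.2 - y.2. Proof. by []. Qed.

Definition hsum_inner (x y : hsum X Y) : R[i] := <|x.1, y.1|> + <|x.2, y.2|>.

Fact hsum_innerDl x y z :
  hsum_inner (x + y) z = hsum_inner x z + hsum_inner y z.
Proof. by rewrite /hsum_inner !innerDl addrACA. Qed.

Fact hsum_innerZl a x z : hsum_inner (a *: x) z = a * hsum_inner x z.
Proof. by rewrite /hsum_inner !innerZl mulrDr. Qed.

Fact hsum_inner_conj x y : hsum_inner y x = (hsum_inner x y)^*.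
Proof. by rewrite /hsum_inner rmorphD/= -!inner_conj. Qed.

Fact hsum_inner_ge0 x : 0 <= hsum_inner x x.
Proof. by rewrite addr_ge0// inner_ge0. Qed.

Fact hsum_inner_eq0 x : hsum_inner x x = 0 -> x = 0.
Proof.
case: x => x1 x2 /eqP.
rewrite paddr_eq0 ?inner_ge0//= => /andP[/eqP/inner_eq0-> /eqP/inner_eq0->].
by [].
Qed.

Fact hsum_complete (F : set_system (hsum X Y)) : ProperFilter F ->
  (forall e : R[i], 0 < e ->
     exists x, F [set y | sqrtC (hsum_inner (x - y) (x - y)) < e]) ->
  exists x, forall e : R[i], 0 < e ->
     F [set y | sqrtC (hsum_inner (x - y) (x - y)) < e].
Proof.
move=> FF Fc.
have le1 (x : hsum X Y) : `|x.1| <= sqrtC (hsum_inner x x).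
  by rewrite -sqrtC_inner ler_sqrtC ?qualifE/= ?hsum_inner_ge0 ?inner_ge0//
    lerDl inner_ge0.
have le2 (x : hsum X Y) : `|x.2| <= sqrtC (hsum_inner x x).
  by rewrite -sqrtC_inner ler_sqrtC ?qualifE/= ?hsum_inner_ge0 ?inner_ge0//
    lerDr inner_ge0.
have [|x1 x1F] := @hilbert_complete R X ((fun x => x.1) @ F) _.
  move=> e /Fc[x xF]; exists x.1; apply: (@filterS _ F FF _ _ _ xF) => y.
  by apply: le_lt_trans; have := le1 (x - y); rewrite hsumB1.
have [|x2 x2F] := @hilbert_complete R Y ((fun x => x.2) @ F) _.
  move=> e /Fc[x xF]; exists x.2; apply: (@filterS _ F FF _ _ _ xF) => y.
  by apply: le_lt_trans; have := le2 (x - y); rewrite hsumB2.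
exists (x1, x2) => e e0.
have e20 : 0 < e / 2 by rewrite divr_gt0.
have F1 : F [set y : hsum X Y | `|x1 - y.1| < e / 2] := x1F _ e20.
have F2 : F [set y : hsum X Y | `|x2 - y.2| < e / 2] := x2F _ e20.
apply: (@filterS _ F FF _ _ _ (filterI F1 F2)) => y [y1 y2] /=.
rewrite /hsum_inner !inner_norm [ltRHS](splitr e).
apply: le_lt_trans (ltrD y1 y2).
exact: sqrtC_sqrD_le.
Qed.

HB.instance Definition _ := Lmodule_isHilbert.Build R (hsum X Y)
  hsum_innerDl hsum_innerZl hsum_inner_conj hsum_inner_ge0 hsum_inner_eq0
  hsum_complete.

Lemma hsum_innerE (x y : hsum X Y) : <|x, y|> = <|x.1, y.1|> + <|x.2, y.2|>.
Proof. by []. Qed.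

End DirectSum.

Section DirectPower.
Context (R : realType) (d : nat) (X : hilbertType R).

HB.instance Definition _ := GRing.Lmodule.copy (hpow d X) {ffun 'I_d -> X}.

Definition hpow_inner (x y : hpow d X) : R[i] := \sum_i <|x i, y i|>.

Fact hpow_innerDl x y z :
  hpow_inner (x + y) z = hpow_inner x z + hpow_inner y z.
Proof. by rewrite -big_split; apply: eq_bigr => i _; rewrite ffunE innerDl. Qed.

Fact hpow_innerZl a x z : hpow_inner (a *: x) z = a * hpow_inner x z.
Proof. by rewrite mulr_sumr; apply: eq_bigr => i _; rewrite ffunE innerZl. Qed.

Fact hpow_inner_conj x y : hpow_inner y x = (hpow_inner x y)^*.
Proof. by rewrite rmorph_sum; apply: eq_bigr => i _; exact: inner_conj. Qed.

Fact hpow_inner_ge0 x : 0 <= hpow_inner x x.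
Proof. by apply: sumr_ge0 => i _; exact: inner_ge0. Qed.

Fact hpow_inner_eq0 x : hpow_inner x x = 0 -> x = 0.
Proof.
move=> /eqP; rewrite psumr_eq0 => [/allP x0|i _]; last exact: inner_ge0.
apply/ffunP => i; rewrite ffunE; apply: inner_eq0.
by apply/eqP; apply: x0; rewrite mem_index_enum.
Qed.

Fact hpow_complete (F : set_system (hpow d X)) : ProperFilter F ->
  (forall e : R[i], 0 < e ->
     exists x, F [set y | sqrtC (hpow_inner (x - y) (x - y)) < e]) ->
  exists x, forall e : R[i], 0 < e ->
     F [set y | sqrtC (hpow_inner (x - y) (x - y)) < e].
Proof.
move=> FF Fc.
have le1 i (x : hpow d X) : `|x i| <= sqrtC (hpow_inner x x).
  rewrite -sqrtC_inner ler_sqrtC ?qualifE/= ?hpow_inner_ge0 ?inner_ge0//.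
  by rewrite /hpow_inner (bigD1 i)//= lerDl sumr_ge0// => j _; exact: inner_ge0.
have xi i : exists x : X, forall e : R[i], 0 < e ->
    F [set y : hpow d X | `|x - y i| < e].
  apply: (@hilbert_complete R X ((fun y : hpow d X => y i) @ F) _).
  move=> e /Fc[x xF]; exists (x i); apply: (@filterS _ F FF _ _ _ xF) => y.
  by apply: le_lt_trans; have := le1 i (x - y); rewrite !ffunE.
have [x xF] := choice xi; exists (finfun x) => e e0.
have ed0 : 0 < e / d.+1%:R by rewrite divr_gt0// ltr0Sn.
have : F [set y : hpow d X | forall i, `|x i - y i| < e / d.+1%:R].
  by apply: (@filter_forall _ _
    (fun i => [set y : hpow d X | `|x i - y i| < e / d.+1%:R])) => i; exact: xF.
apply: (@filterS _ F FF) => y xy /=.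
rewrite /hpow_inner.
under eq_bigr do rewrite !ffunE inner_norm.
apply: le_lt_trans (sqrtC_sum_sqr_le _) _ => //.
apply: (@le_lt_trans _ _ (\sum_(i < d) e / d.+1%:R)).
  by apply: ler_sum => i _; apply: ltW; exact: xy.
rewrite sumr_const card_ord -[ltLHS]mulr_natr -mulrA gtr_pMr//.
by rewrite mulrC ltr_pdivrMr ?ltr0Sn// mul1r ltr_nat.
Qed.

HB.instance Definition _ := Lmodule_isHilbert.Build R (hpow d X)
  hpow_innerDl hpow_innerZl hpow_inner_conj hpow_inner_ge0 hpow_inner_eq0
  hpow_complete.

Lemma hpow_innerE (x y : hpow d X) : <|x, y|> = \sum_i <|x i, y i|>.
Proof. by []. Qed.

End DirectPower.

Definition bounded_op (R : realType) (X Y : hilbertType R) : pred (X -> Y) :=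
  fun f => `[< linear f /\ exists M : R[i], forall x, `|f x| <= M * `|x| >].

Record bop (R : realType) (X Y : hilbertType R) : Type := Bop {
  bop_fun :> X -> Y;
  bop_bounded : bop_fun \in @bounded_op R X Y
}.

Section BoundedOperators.
Context (R : realType) (X Y : hilbertType R).

Lemma bounded_opP (f : X -> Y) : reflect
  (linear f /\ exists M : R[i], forall x, `|f x| <= M * `|x|)
  (f \in @bounded_op R X Y).
Proof. exact: asboolP. Qed.

Fact bounded_op_submod : GRing.submod_closed (@bounded_op R X Y).
Proof.
split=> [|a f g /bounded_opP[flin [M fM]] /bounded_opP[glin [N gN]]].
  apply/bounded_opP; split=> [b x y|]; first by rewrite scaler0 addr0.
  by exists 0 => x; rewrite normr0 mul0r.
apply/bounded_opP; split=> [b x y|].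
  change (a *: f (b *: x + y) + g (b *: x + y) =
    b *: (a *: f x + g x) + (a *: f y + g y)).
  rewrite flin glin !scalerDr !scalerA (mulrC b a) -!addrA; congr (_ + _).
  by rewrite !addrA; congr (_ + _); rewrite addrC.
exists (`|a| * M + N) => x; rewrite mulrDl -mulrA.
apply: le_trans (ler_normD _ _) _.
by rewrite lerD// normrZ ler_wpM2l.
Qed.

HB.instance Definition _ :=
  GRing.isSubmodClosed.Build R[i] (X -> Y) (@bounded_op R X Y)
    bounded_op_submod.
HB.instance Definition _ := [isSub for @bop_fun R X Y].
HB.instance Definition _ := [Choice of bop X Y by <:].
HB.instance Definition _ := [SubChoice_isSubLmodule of bop X Y by <:].

Fact bop_linear (T : bop X Y) : linear T.
Proof. by have /bounded_opP[] := bop_bounded T. Qed.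

HB.instance Definition _ (T : bop X Y) :=
  GRing.isLinear.Build R[i] X Y *:%R T (bop_linear T).

Lemma bop_bound (T : bop X Y) :
  exists M : R[i], forall x, `|T x| <= M * `|x|.
Proof. by have /bounded_opP[] := bop_bounded T. Qed.

Lemma bop_bound_ge0 (T : bop X Y) :
  exists2 M : R[i], 0 <= M & forall x, `|T x| <= M * `|x|.
Proof.
have [M TM] := bop_bound T; exists `|M| => // x.
have [x0|x0] := eqVneq `|x| 0.
  by have := TM x; rewrite x0 !mulr0.
suff M0 : 0 <= M by rewrite ger0_norm.
by rewrite -(@pmulr_lge0 _ `|x|) ?(le_trans _ (TM x))// lt_def x0/=.
Qed.

Lemma bopP (S T : bop X Y) : S =1 T -> S = T.
Proof. by move=> ST; apply/val_inj/funext. Qed.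

Lemma bopDE (S T : bop X Y) x : (S + T) x = S x + T x.
Proof. by []. Qed.

Lemma bopNE (T : bop X Y) x : (- T) x = - T x.
Proof. by []. Qed.

Lemma bopZE a (T : bop X Y) x : (a *: T) x = a *: T x.
Proof. by []. Qed.

Lemma bop0E x : (0 : bop X Y) x = 0.
Proof. by []. Qed.

End BoundedOperators.

Section Composition.
Context (R : realType).

Fact bop_id_bounded (X : hilbertType R) : idfun \in @bounded_op R X X.
Proof. by apply/bounded_opP; split=> //; exists 1 => x; rewrite mul1r. Qed.

Definition bop_id (X : hilbertType R) : bop X X := Bop (bop_id_bounded X).

Fact bop_comp_bounded (X Y Z : hilbertType R) (S : bop Y Z) (T : bop X Y) :
  S \o T \in @bounded_op R X Z.
Proof.
apply/bounded_opP; split=> [a x y|]; first by rewrite /= !linearP.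
have [M M0 SM] := bop_bound_ge0 S; have [N TN] := bop_bound T.
exists (M * N) => x /=; apply: le_trans (SM _) _.
by rewrite -mulrA ler_wpM2l.
Qed.

Definition bop_comp (X Y Z : hilbertType R) (S : bop Y Z) (T : bop X Y) :
  bop X Z := Bop (bop_comp_bounded S T).

End Composition.

Notation "S '\oB' T" := (bop_comp S T)
  (at level 40, left associativity, format "S  \oB  T") : ring_scope.

Section AdjointInverse.
Context (R : realType) (X Y : hilbertType R).

Definition is_adjoint (T : bop X Y) (T' : bop Y X) : Prop :=
  forall x y, <|T x, y|> = <|x, T' y|>.

(* The adjoint exists and is unique for every [T]. *)
Definition adj (T : bop X Y) : bop Y X := xget 0 [set T' | is_adjoint T T'].

Definition is_inverse (T : bop X Y) (T' : bop Y X) : Prop :=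
  T' \oB T = bop_id X /\ T \oB T' = bop_id Y.

(* The bounded inverse, [0] when [T] is not invertible. *)
Definition bop_inv (T : bop X Y) : bop Y X := xget 0 [set T' | is_inverse T T'].

Definition contractive (T : bop X Y) : Prop := forall x, `|T x| <= `|x|.

Definition isometric_on (D : set X) (T : X -> Y) : Prop :=
  forall x, D x -> `|T x| = `|x|.

Definition unitary (T : bop X Y) : Prop :=
  adj T \oB T = bop_id X /\ T \oB adj T = bop_id Y.

End AdjointInverse.

Section ClosedSpan.
Context (R : realType) (X : hilbertType R).

Definition lin_span (A : set X) : set X :=
  [set x | exists n (c : 'I_n -> R[i]) (a : 'I_n -> X),
     (forall i, A (a i)) /\ x = \sum_i c i *: a i].

Definition closed_span (A : set X) : set X := closure (lin_span A).

End ClosedSpan.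

Lemma sqrtC_le (R : realType) (a b : R[i]) :
  0 <= a -> a <= b -> sqrtC a <= sqrtC b.
Proof. by move=> a0 ab; rewrite ler_sqrtC// qualifE/= (le_trans a0). Qed.

Section PowerNorm.
Context (R : realType) (d : nat) (X : hilbertType R).

Lemma hpow_norm_le_sum (x : hpow d X) : `|x| <= \sum_i `|x i|.
Proof.
rewrite -sqrtC_inner hpow_innerE.
under eq_bigr do rewrite inner_norm.
exact: sqrtC_sum_sqr_le.
Qed.

Lemma hpow_coord_le (x : hpow d X) i : `|x i| <= `|x|.
Proof.
rewrite -!sqrtC_inner; apply: sqrtC_le; rewrite ?inner_ge0//.
by rewrite hpow_innerE (bigD1 i)//= lerDl sumr_ge0// => j _; exact: inner_ge0.
Qed.

End PowerNorm.

Section SumNorm.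
Context (R : realType) (X Y : hilbertType R).

Lemma hsum_norm_le_sum (x : hsum X Y) : `|x| <= `|x.1| + `|x.2|.
Proof. by rewrite -[leLHS]sqrtC_inner hsum_innerE !inner_norm sqrtC_sqrD_le. Qed.

Lemma hsum_fst_le (x : hsum X Y) : `|x.1| <= `|x|.
Proof.
rewrite -!sqrtC_inner; apply: sqrtC_le; rewrite ?inner_ge0//.
by rewrite hsum_innerE lerDl inner_ge0.
Qed.

Lemma hsum_snd_le (x : hsum X Y) : `|x.2| <= `|x|.
Proof.
rewrite -!sqrtC_inner; apply: sqrtC_le; rewrite ?inner_ge0//.
by rewrite hsum_innerE lerDr inner_ge0.
Qed.

End SumNorm.

Section PowerOperators.
Context (R : realType) (d : nat).

Fact slot_bounded (X : hilbertType R) (i : 'I_d) :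
  (fun x : X => [ffun j => if j == i then x else 0] : hpow d X)
    \in @bounded_op R X (hpow d X).
Proof.
apply/bounded_opP; split=> [a x y|].
  apply/ffunP => j; rewrite !ffunE; case: ifP => // _.
  by rewrite scaler0 addr0.
exists 1 => x; rewrite mul1r; apply: le_trans (hpow_norm_le_sum _) _.
rewrite (bigD1 i)//= ffunE eqxx big1 ?addr0// => j ji.
by rewrite ffunE (negPf ji) normr0.
Qed.

Definition slot (X : hilbertType R) (i : 'I_d) : bop X (hpow d X) :=
  Bop (slot_bounded X i).

Fact dsum_bounded (X Y : hilbertType R) (T : bop X Y) :
  (fun x : hpow d X => [ffun i => T (x i)] : hpow d Y)
    \in @bounded_op R (hpow d X) (hpow d Y).
Proof.
apply/bounded_opP; split=> [a x y|].
  by apply/ffunP => i; rewrite !ffunE linearP.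
have [M M0 TM] := bop_bound_ge0 T; exists (\sum_(i < d) M) => x.
apply: le_trans (hpow_norm_le_sum _) _; rewrite mulr_suml; apply: ler_sum => i _.
rewrite ffunE; apply: le_trans (TM _) _.
by rewrite ler_wpM2l// hpow_coord_le.
Qed.

Definition dsum (X Y : hilbertType R) (T : bop X Y) :
  bop (hpow d X) (hpow d Y) := Bop (dsum_bounded T).

Definition block (X Y : hilbertType R) (i j : 'I_d)
  (T : bop (hpow d X) (hpow d Y)) : bop X Y := adj (slot Y i) \oB T \oB slot X j.

Definition block_op (X Y : hilbertType R) (T : 'I_d -> 'I_d -> bop X Y) :
  bop (hpow d X) (hpow d Y) :=
  \sum_i \sum_j slot Y i \oB T i j \oB adj (slot X j).

End PowerOperators.

Record uball (R : realType) (d : nat) : Type := UBall {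
  uball_val :> 'rV[R[i]]_d;
  _ : \sum_i `|uball_val 0 i| ^+ 2 < 1
}.

Section Ball.
Context (R : realType) (d : nat).

Fact uball0_subproof : \sum_i `|(0 : 'rV[R[i]]_d) 0 i| ^+ 2 < 1.
Proof. by rewrite big1// => i _; rewrite mxE normr0 expr0n. Qed.

Definition uball0 : uball R d := UBall uball0_subproof.

Definition cdot (z w : 'rV[R[i]]_d) : R[i] := \sum_i z 0 i * (w 0 i)^*.

Fact Zop_bounded (X : hilbertType R) (z : 'rV[R[i]]_d) :
  (fun x : hpow d X => \sum_j z 0 j *: x j) \in @bounded_op R (hpow d X) X.
Proof.
apply/bounded_opP; split=> [a x y|].
  rewrite scaler_sumr -big_split; apply: eq_bigr => j _.
  by rewrite !ffunE scalerDr !scalerA mulrC.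
exists (\sum_j `|z 0 j|) => x; apply: le_trans (ler_norm_sum _ _ _) _.
rewrite mulr_suml; apply: ler_sum => j _.
by rewrite normrZ ler_wpM2l// hpow_coord_le.
Qed.

(* The row operator [z_1 I ... z_d I] from [X^d] to [X]. *)
Definition Zop (X : hilbertType R) (z : 'rV[R[i]]_d) : bop (hpow d X) X :=
  Bop (Zop_bounded X z).

End Ball.

Definition positive_kernel (R : realType) (W : Type) (E : hilbertType R)
    (K : W -> W -> bop E E) : Prop :=
  forall n (z : 'I_n -> W) (c : 'I_n -> E),
    0 <= \sum_i \sum_j <|K (z i) (z j) (c j), c i|>.

(* A Hilbert space of [E]-valued functions on [W] with reproducing kernel [K]:
   a vector [f] is identified with the function [rk_eval f], and [rk_ker w c]
   is the function [K(., w) c].  This determines the space up to the unique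
   unitary map that respects evaluation. *)
Record rkhs (R : realType) (W : Type) (E : hilbertType R)
    (K : W -> W -> bop E E) := RKHS {
  rk_space :> hilbertType R;
  rk_eval : rk_space -> W -> E;
  rk_evalP : forall z, linear (rk_eval ^~ z);
  rk_eval_inj : injective rk_eval;
  rk_ker : W -> E -> rk_space;
  rk_kerE : forall w c z, rk_eval (rk_ker w c) z = K z w c;
  rk_repr : forall f w c, <|f, rk_ker w c|> = <|rk_eval f w, c|>
}.

Definition schur_class (R : realType) (d : nat) (U Y : hilbertType R)
    (S : uball R d -> bop U Y) : Prop :=
  positive_kernel (fun z w : uball R d =>
    (1 - cdot z w)^-1 *: (bop_id Y - S z \oB adj (S w))).

Record colligation (R : realType) (d : nat) (X U Y : hilbertType R) :=
  Colligation {
  colA : bop X (hpow d X);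
  colB : bop U (hpow d X);
  colC : bop X Y;
  colD : bop U Y
}.

Section Colligations.
Context (R : realType) (d : nat) (X U Y : hilbertType R).
Variable M : colligation d X U Y.
Local Notation A := (colA M).
Local Notation B := (colB M).
Local Notation C := (colC M).
Local Notation D := (colD M).

Fact colop_bounded :
  (fun x : hsum X U => (A x.1 + B x.2, C x.1 + D x.2) : hsum (hpow d X) Y)
    \in @bounded_op R (hsum X U) (hsum (hpow d X) Y).
Proof.
apply/bounded_opP; split=> [a [x u] [y v]|].
  have distr (V : lmodType R[i]) (p q r s : V) :
      a *: p + q + (a *: r + s) = a *: (p + r) + (q + s).
    by rewrite scalerDr addrACA.
  by rewrite /= !linearP !distr.
have [a a0 Aa] := bop_bound_ge0 A; have [b b0 Bb] := bop_bound_ge0 B.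
have [c c0 Cc] := bop_bound_ge0 C; have [e e0 De] := bop_bound_ge0 D.
exists ((a + b) + (c + e)) => x; apply: le_trans (hsum_norm_le_sum _) _.
rewrite !mulrDl lerD//= (le_trans (ler_normD _ _))// lerD//.
- by apply: le_trans (Aa _) _; rewrite ler_wpM2l// hsum_fst_le.
- by apply: le_trans (Bb _) _; rewrite ler_wpM2l// hsum_snd_le.
- by apply: le_trans (Cc _) _; rewrite ler_wpM2l// hsum_fst_le.
- by apply: le_trans (De _) _; rewrite ler_wpM2l// hsum_snd_le.
Qed.

Definition colop : bop (hsum X U) (hsum (hpow d X) Y) := Bop colop_bounded.

Definition charfun (z : uball R d) : bop U Y :=
  D + C \oB bop_inv (bop_id X - Zop X z \oB A) \oB Zop X z \oB B.

Definition controllable : Prop :=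
  closed_span [set x | exists (z : uball R d) u j,
    x = (adj (slot X j) \oB bop_inv (bop_id _ - A \oB Zop X z) \oB B) u]
  = setT.

Definition Dtilde_AB : set X :=
  closed_span [set x | exists (z : uball R d) u,
    x = (Zop X z \oB bop_inv (bop_id _ - A \oB Zop X z) \oB B) u].

Definition weakly_isometric : Prop :=
  contractive colop /\ isometric_on [set x : hsum X U | Dtilde_AB x.1] colop.

(* The kernel with blocks
   B^* (I - Z(z)^* A^* )^-1 I_i I_l^* (I - A Z(w))^-1 B. *)
Definition col_kernel (z w : uball R d) : bop (hpow d U) (hpow d U) :=
  block_op (fun i l =>
    adj B \oB bop_inv (bop_id _ - adj (Zop X z) \oB adj A) \oB slot X i
    \oB adj (slot X l) \oB bop_inv (bop_id _ - A \oB Zop X w) \oB B).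

End Colligations.

Definition unitarily_equivalent (R : realType) (d : nat)
    (X X' U Y : hilbertType R)
    (M : colligation d X U Y) (M' : colligation d X' U Y) : Prop :=
  colD M = colD M' /\
  exists T : bop X X', unitary T /\
    [/\ dsum d T \oB colA M = colA M' \oB T,
        dsum d T \oB colB M = colB M' &
        colC M = colC M' \oB T].

Definition kernel_decomposition (R : realType) (d : nat) (U Y : hilbertType R)
    (S : uball R d -> bop U Y)
    (Phi : uball R d -> uball R d -> bop (hpow d U) (hpow d U)) : Prop :=
  forall z w : uball R d,
    bop_id U - adj (S z) \oB S w =
    \sum_j block j j (Phi z w) -
    \sum_i \sum_l ((z 0 i)^* * w 0 l) *: block i l (Phi z w).

Section FunctionalModel.
Context (R : realType) (d : nat) (U Y : hilbertType R).
Variables (S : uball R d -> bop U Y)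
  (Phi : uball R d -> uball R d -> bop (hpow d U) (hpow d U)) (H : rkhs Phi).

(* The function [Phi_{.j}(., w) u], the [j]-th block column of [Phi] being
   [Phi] restricted to the [j]-th slot. *)
Definition phi_col (j : 'I_d) (w : uball R d) (u : U) : H :=
  rk_ker H w (slot U j u).

Definition phi_T (w : uball R d) (u : U) : hpow d H :=
  [ffun j => phi_col j w u].

Definition phi_Z (w : uball R d) (u : U) : H := \sum_j w 0 j *: phi_col j w u.

Definition Dtilde : set H :=
  closed_span [set h | exists (w : uball R d) u, h = phi_Z w u].

Definition Vtilde_dom : set (hsum H U) := [set x | Dtilde x.1].

(* [V] restricted to [Vtilde_dom] is the isometry of the decomposition; the
   values of [V] elsewhere are irrelevant. *)
Record is_Vtilde (V : hsum H U -> hsum (hpow d H) Y) : Prop := {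
  Vtilde_linear : forall a x y, Vtilde_dom x -> Vtilde_dom y ->
    V (a *: x + y) = a *: V x + V y;
  Vtilde_isometric : isometric_on Vtilde_dom V;
  Vtilde_gen : forall w u, V (phi_Z w u, u) = (phi_T w u, S w u)
}.

Definition contractive_extension (V : hsum H U -> hsum (hpow d H) Y)
    (M : colligation d H U Y) : Prop :=
  contractive (colop M) /\ forall x, Vtilde_dom x -> colop M x = V x.

Definition dcfm_colligation (M : colligation d H U Y) : Prop :=
  contractive (colop M) /\
  forall (w : uball R d) (u : U),
    [/\ colA M (phi_Z w u) = phi_T w u - phi_T (uball0 R d) u,
        colC M (phi_Z w u) = S w u - S (uball0 R d) u,
        colB M u = phi_T (uball0 R d) u &
        colD M u = S (uball0 R d) u].

End FunctionalModel.

Arguments is_Vtilde {R d U Y} S {Phi} H V.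
Arguments kernel_decomposition {R d U Y} S Phi.
Arguments dcfm_colligation {R d U Y} S {Phi H} M.
Arguments contractive_extension {R d U Y Phi H} V M.

(* Main.v *)
Require Import Defs.
From HB Require Import structures.
From mathcomp Require Import all_boot all_order all_algebra.
From mathcomp Require Import complex.
From mathcomp Require Import boolp classical_sets functions reals.
From mathcomp Require Import topology normedtype.
From mathcomp Require Import ring lra.

Set Implicit Arguments.
Unset Strict Implicit.
Unset Printing Implicit Defensive.

Import Order.TTheory GRing.Theory Num.Theory.
Import numFieldNormedType.Exports.

Local Open Scope classical_set_scope.
Local Open Scope ring_scope.

(* By the decomposition, the families [(sum_j w_j Phi_{.j}(., w) u, u)] and
   [(T(., w) u, S(w) u)] have the same Gram matrix, so that a contraction maps the
   first to the second, isometrically on the closed span; a d.c.f.m. colligation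
   is the same thing as such a contraction.  Its values on the first family say
   that [T(., w) u] solves [x = A Z(w) x + B u], which turns [(I - A Z(w))^-1 B u]
   into [T(., w) u]: the characteristic function, weak isometry and
   controllability are read off from there.  Conversely, the weak isometry of a
   colligation with states [x_w u = (I - A Z(w))^-1 B u] yields the decomposition
   for the Gram kernel of the components of the states, and controllability makes
   the map from these components to the kernel functions a unitary.

   [I - A Z(w)] is inverted without the Neumann series, as an operator that is
   bounded below and whose range has trivial orthogonal complement. *)

(** * Inner products *)

(** The setting shapes the work. [R[i]] is only partially ordered, so infima and suprema are taken
    in [R]. Limits are replaced by families of sets indexed by positive [e : R[i]], which are real
    and hence comparable, and a quantity is shown to vanish by bounding it by a fixed multiple of
    every [e]. Adjoints and inverses are chosen with default [0], so their existence has to be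
    established before anything can be computed with them.

    The Gram data yield an operator on the whole space rather than an isometry on a closed span:
    vanishing on the orthogonal complement gives a d.c.f.m. colligation at once, and [Vtilde] by
    restriction.

    The origin belongs to the ball and [phi_Z] vanishes there. This places every [(0, u)] among the
    generators [(phi_Z w u, u)], and it is why the four defining equations of a d.c.f.m. colligation
    amount to its values on that single family. *)

Section Scalars.
Variable F : numFieldType.

(** Testing at [e = x / (2 C)] would give [x <= x / 2]. This replaces passage to the limit in most
    closedness and uniqueness arguments below. *)
Lemma le_eps_eq0 (C x : F) : 0 <= x -> (forall e, 0 < e -> x <= C * e) -> x = 0.
Proof.
move=> x0 xC; apply/eqP; apply: contraT => xn0.
have {xn0}x0 : 0 < x by rewrite lt_def xn0.
have C0 : 0 < C by have := xC 1 ltr01; rewrite mulr1; apply: lt_le_trans.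
have := xC (x / (C * 2)); rewrite divr_gt0 ?mulr_gt0// => /(_ isT).
have -> : C * (x / (C * 2)) = x / 2 by field; rewrite ?gt_eqF.
by have := (midf_lt x0).2; rewrite add0r => x2 /le_lt_trans/(_ x2); rewrite ltxx.
Qed.

End Scalars.

(** The discriminant argument with an abstract cross term [d]. It thus serves inner products, the
    kernel form before any Hilbert space is available, and near-minimal points of a distance. For
    [b > 0] the choice [t = d / b] is optimal. *)
Lemma scalar_cauchy_schwarz (F : numClosedFieldType) (a b d : F) : 0 <= b ->
  (forall t, 0 <= a - t * d^* - t^* * d + t * t^* * b) -> `|d| ^+ 2 <= a * b.
Proof.
move=> b0 H; have a0 : 0 <= a by have := H 0; rewrite conjC0 !mul0r !subr0 addr0.
have [bE|bn0] := eqVneq b 0.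
  rewrite bE mulr0; suff -> : `|d| = 0 by rewrite expr0n.
  apply/eqP; apply: contraT => dn0.
  have d20 : 0 < `|d| ^+ 2 by rewrite exprn_gt0// lt_def dn0/=.
  (* At [t = s * d] the hypothesis would read [0 <= - (a + 2)]. *)
  pose s := (a + 1) / `|d| ^+ 2.
  have sr : s^* = s.
    apply/CrealP; apply: ger0_real; apply: divr_ge0; last exact: ltW.
    exact: addr_ge0.
  have := H (s * d); rewrite bE mulr0 addr0 rmorphM/= sr.
  have -> : a - s * d * d^* - s * d^* * d = - (a + 2).
    have -> : a - s * d * d^* - s * d^* * d = a - 2 * (s * `|d| ^+ 2).
      by rewrite normCK; ring.
    by rewrite /s divfK ?gt_eqF//; ring.
  by rewrite oppr_ge0 => /(lt_le_trans (ltr_wpDl a0 (ltr0Sn _ 1))); rewrite ltxx.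
have {b0}b0 : 0 < b by rewrite lt_def bn0.
have br : b^* = b by apply/CrealP; apply: ger0_real; exact: ltW.
have := H (d / b); rewrite fmorph_div/= br.
set e := (X in 0 <= X); have -> : e = a - `|d| ^+ 2 / b.
  by rewrite /e normCK; field; rewrite bn0.
by rewrite subr_ge0 ler_pdivrMr.
Qed.

Section InnerProduct.
Context {R : realType} {H : hilbertType R}.
Implicit Types x y z : H.

Lemma innerDr x y z : <|z, x + y|> = <|z, x|> + <|z, y|>.
Proof. by rewrite inner_conj innerDl rmorphD/= -!inner_conj. Qed.

Lemma innerZr a x z : <|z, a *: x|> = a^* * <|z, x|>.
Proof. by rewrite inner_conj innerZl rmorphM/= -inner_conj. Qed.

Lemma innerNl x z : <|- x, z|> = - <|x, z|>.
Proof. by rewrite -scaleN1r innerZl mulN1r. Qed.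

Lemma innerNr x z : <|z, - x|> = - <|z, x|>.
Proof. by rewrite inner_conj innerNl rmorphN/= -inner_conj. Qed.

Lemma innerBl x y z : <|x - y, z|> = <|x, z|> - <|y, z|>.
Proof. by rewrite innerDl innerNl. Qed.

Lemma innerBr x y z : <|z, x - y|> = <|z, x|> - <|z, y|>.
Proof. by rewrite innerDr innerNr. Qed.

Lemma inner0l z : <|0, z|> = 0.
Proof. by rewrite -(subrr z) innerBl subrr. Qed.

Lemma inner0r z : <|z, 0|> = 0.
Proof. by rewrite -(subrr z) innerBr subrr. Qed.

Lemma inner_suml I (r : seq I) (P : pred I) (f : I -> H) z :
  <|\sum_(i <- r | P i) f i, z|> = \sum_(i <- r | P i) <|f i, z|>.
Proof.
by apply: (big_morph (fun x => <|x, z|>) (fun x y => innerDl x y z) (inner0l z)).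
Qed.

Lemma inner_sumr I (r : seq I) (P : pred I) (f : I -> H) z :
  <|z, \sum_(i <- r | P i) f i|> = \sum_(i <- r | P i) <|z, f i|>.
Proof.
by apply: (big_morph (fun x => <|z, x|>) (fun x y => innerDr x y z) (inner0r z)).
Qed.

Lemma inner_inj x y : (forall z, <|x, z|> = <|y, z|>) -> x = y.
Proof.
move=> xy; apply/eqP; rewrite -subr_eq0; apply/eqP/inner_eq0.
by rewrite innerBl xy subrr.
Qed.

Lemma norm2B x y : `|x - y| ^+ 2 = `|x| ^+ 2 - <|x, y|> - <|y, x|> + `|y| ^+ 2.
Proof. by rewrite -!inner_norm innerBl !innerBr; ring. Qed.

Lemma norm2D x y : `|x + y| ^+ 2 = `|x| ^+ 2 + <|x, y|> + <|y, x|> + `|y| ^+ 2.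
Proof. by rewrite -!inner_norm innerDl !innerDr; ring. Qed.

Lemma parallelogram x y :
  `|x + y| ^+ 2 + `|x - y| ^+ 2 = 2 * (`|x| ^+ 2 + `|y| ^+ 2).
Proof.
by rewrite norm2D norm2B; ring.
Qed.

Lemma cauchy_schwarz_sqr x y : `|<|x, y|>| ^+ 2 <= `|x| ^+ 2 * `|y| ^+ 2.
Proof.
apply: scalar_cauchy_schwarz; first exact: exprn_ge0.
move=> t; have := exprn_ge0 2 (normr_ge0 (x - t *: y)).
rewrite norm2B innerZr innerZl normrZ exprMn normCK -inner_conj.
by rewrite (addrAC _ (- (t^* * _))).
Qed.

Lemma cauchy_schwarz x y : `|<|x, y|>| <= `|x| * `|y|.
Proof.
by rewrite -(@ler_pXn2r _ 2%N)// ?nnegrE ?mulr_ge0// exprMn cauchy_schwarz_sqr.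
Qed.

Lemma sqr_norm_inj x (y : R[i]) : 0 <= y -> `|x| ^+ 2 = y ^+ 2 -> `|x| = y.
Proof. by move=> y0 /eqP; rewrite eqrXn2// => /eqP. Qed.

End InnerProduct.

Section Polarization.
Context {R : realType} {H K : hilbertType R}.

(* Polarization: it suffices to compare the norms of [a x + y] for [a] in [1, i]. *)
Lemma isometry_inner (D : set H) (T : H -> K) :
  (forall a x y, D x -> D y -> D (a *: x + y) /\ T (a *: x + y) = a *: T x + T y) ->
  isometric_on D T -> forall x y, D x -> D y -> <|T x, T y|> = <|x, y|>.
Proof.
move=> Tlin Tiso x y Dx Dy.
have key a : a^* * <|T y, T x|> + a * <|T x, T y|> = a^* * <|y, x|> + a * <|x, y|>.
  have [Dxy Txy] := Tlin a x y Dx Dy.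
  have := congr1 (fun r => r ^+ 2) (Tiso _ Dxy).
  rewrite Txy !norm2D !normrZ !Tiso// !innerZl !innerZr => /addIr.
  by rewrite -!addrA => /addrI; rewrite addrC => ->; rewrite addrC.
have := key 1; have := key 'i; rewrite conjCi conjC1 !mul1r !mulNr.
set a := <|T y, _|>; set b := <|T x, _|>; set c := <|y, _|>; set e := <|x, _|>.
move=> h1 h2; have i2 : 'i * 'i = -1 :> R[i] by rewrite -expr2 sqrCi.
have h3 : a - b = c - e.
  have -> : a - b = 'i * (- 'i * a + 'i * b).
    by rewrite mulrDr mulNr mulrN !mulrA i2; ring.
  by rewrite mulNr h1 mulrDr mulrN !mulrA i2; ring.
have : b *+ 2 = e *+ 2.
  have -> : b *+ 2 = (a + b) - (a - b) by ring.
  by rewrite h2 h3; ring.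
by move=> /eqP; rewrite eqrMn2r => /eqP.
Qed.

End Polarization.

(** * Closed subspaces and orthogonal projection *)

Section BopLinearity.
Context {R : realType} {X Y : hilbertType R} (T : bop X Y).

Lemma bop0r : T 0 = 0. Proof. exact: linear0. Qed.
Lemma bopDr x y : T (x + y) = T x + T y. Proof. exact: linearD. Qed.
Lemma bopBr x y : T (x - y) = T x - T y. Proof. exact: linearB. Qed.
Lemma bopZr a x : T (a *: x) = a *: T x. Proof. exact: linearZ. Qed.
Lemma bop_sumr I (r : seq I) (P : pred I) (f : I -> X) :
  T (\sum_(i <- r | P i) f i) = \sum_(i <- r | P i) T (f i).
Proof. exact: linear_sum. Qed.

End BopLinearity.

Section ClosedSubspaces.
Context {R : realType}.

(** Closedness is phrased by approximation in norm, so that it can be checked with [le_eps_eq0] and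
    without filters. *)
Record closed_subspace (H : hilbertType R) (D : set H) : Prop := ClosedSubspace {
  subspace0 : D 0;
  subspaceP : forall a x y, D x -> D y -> D (a *: x + y);
  subspace_closed : forall x, (forall e : R[i], 0 < e ->
    exists2 a, D a & `|x - a| < e) -> D x }.

Lemma closureE_norm (H : hilbertType R) (A : set H) x : closure A x <->
  forall e : R[i], 0 < e -> exists2 a, A a & `|x - a| < e.
Proof.
split=> [Ax e e0|Ax B /nbhs_ballP[e e0 eB]].
  have [a [Aa xa]] := Ax _ (nbhsx_ballx x e e0).
  by exists a => //; move: xa; rewrite -ball_normE.
have [a Aa xa] := Ax e e0; exists a; split=> //; apply: eB.
by rewrite -ball_normE.
Qed.

Section Theory.
Context {H : hilbertType R}.
Implicit Types (A D : set H).

Lemma subspaceZ D a x : closed_subspace D -> D x -> D (a *: x).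
Proof. by move=> sD Dx; rewrite -[_ *: _]addr0; apply: subspaceP => //; case: sD. Qed.

Lemma subspaceD D x y : closed_subspace D -> D x -> D y -> D (x + y).
Proof. by move=> sD Dx Dy; rewrite -[x]scale1r; apply: subspaceP. Qed.

Lemma subspaceB D x y : closed_subspace D -> D x -> D y -> D (x - y).
Proof. by move=> sD Dx Dy; rewrite addrC -scaleN1r; apply: subspaceP. Qed.

Lemma subspace_sum D I (r : seq I) (P : pred I) (f : I -> H) :
  closed_subspace D -> (forall i, D (f i)) -> D (\sum_(i <- r | P i) f i).
Proof.
by move=> sD Df; apply: big_ind => //; [case: sD|move=> x y; exact: subspaceD].
Qed.

Lemma lin_spanP A a x y : lin_span A x -> lin_span A y -> lin_span A (a *: x + y).
Proof.
move=> [n [c [u [Au ->]]]] [m [e [v [Av ->]]]].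
exists (n + m)%N,
  (fun i => match fintype.split i with inl j => a * c j | inr j => e j end),
  (fun i => match fintype.split i with inl j => u j | inr j => v j end).
split=> [i|]; first by case: (fintype.split i).
rewrite big_split_ord scaler_sumr; congr (_ + _); apply: eq_bigr => i _.
  by rewrite (unsplitK (inl i)) scalerA.
by rewrite (unsplitK (inr i)).
Qed.

Lemma closed_span_subspace A : closed_subspace (closed_span A).
Proof.
split=> [|a x y /closureE_norm Ax /closureE_norm Ay|x Ax].
- apply: subset_closure; exists 0%N, (fun=> 0), (fun=> 0).
  by split=> [[]//|]; rewrite big_ord0.
- apply/closureE_norm => e e0.
  have d0 : 0 < e / (2 * (`|a| + 1)) by rewrite divr_gt0// mulr_gt0// ltr_wpDl.
  have [u Au xu] := Ax _ d0.
  have [v Av yv] := Ay (e / 2) (divr_gt0 e0 (ltr0Sn _ 1)).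
  exists (a *: u + v); first exact: lin_spanP.
  have -> : a *: x + y - (a *: u + v) = a *: (x - u) + (y - v).
    by rewrite opprD addrACA scalerBr.
  rewrite [ltRHS](splitr e); apply: le_lt_trans (ler_normD _ _) _.
  rewrite ler_ltD// normrZ; apply: (@le_trans _ _ (`|a| * (e / (2 * (`|a| + 1))))).
    by rewrite ler_wpM2l// ltW.
  have a1 : 0 < `|a| + 1 by rewrite ltr_wpDl.
  have -> : `|a| * (e / (2 * (`|a| + 1))) = e / 2 * (`|a| / (`|a| + 1)).
    by field; rewrite gt_eqF.
  rewrite ler_piMr ?(ltW (divr_gt0 e0 _))// ler_pdivrMr// mul1r lerDl.
  exact: ler01.
- apply/closureE_norm => e e0.
  have e20 : 0 < e / 2 by rewrite divr_gt0.
  have [y /closureE_norm Ay xy] := Ax _ e20; have [z Az yz] := Ay _ e20.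
  exists z => //; rewrite [ltRHS](splitr e) -(subrK y x) -addrA.
  by apply: le_lt_trans (ler_normD _ _) _; exact: ltrD.
Qed.

Lemma sub_closed_span A : A `<=` closed_span A.
Proof.
move=> x Ax; apply: subset_closure; exists 1%N, (fun=> 1), (fun=> x).
by split=> //; rewrite big_ord1 scale1r.
Qed.

(** Serves as induction on a closed span: the property to be shown is phrased as membership in a
    closed subspace, such as an orthogonal complement, an equalizer or a preimage. *)
Lemma closed_span_min A D : closed_subspace D -> A `<=` D -> closed_span A `<=` D.
Proof.
move=> sD AD x /closureE_norm Ax; apply: subspace_closed => // e /Ax[a aA xa].
exists a => //; case: aA => n [c [u [Au ->]]]; apply: subspace_sum => // i.
by apply: subspaceZ => //; exact: AD.
Qed.

Lemma closed_subspace_orth (y : H) : closed_subspace [set x | <|x, y|> = 0].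
Proof.
split=> [|a x z xy zy|x xA] /=; first by rewrite inner0l.
  by rewrite innerDl innerZl xy zy mulr0 addr0.
apply/normr0_eq0/(@le_eps_eq0 _ `|y|) => // e /xA[a /= ay xa].
have -> : <|x, y|> = <|x - a, y|> by rewrite innerBl ay subr0.
by apply: le_trans (cauchy_schwarz _ _) _; rewrite mulrC ler_wpM2l// ltW.
Qed.

Lemma closed_subspace_eq (K : hilbertType R) (S T : bop H K) :
  closed_subspace [set x | S x = T x].
Proof.
split=> [|a x y /= xE yE|x xA] /=; first by rewrite !bop0r.
  by rewrite !bop_linear xE yE.
have [M M0 MST] := bop_bound_ge0 (S - T).
apply/eqP; rewrite -subr_eq0 -normr_eq0; apply/eqP.
apply: (@le_eps_eq0 _ M) => // e /xA[a /= aE xa].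
have -> : S x - T x = (S - T) (x - a).
  by rewrite bopDE bopNE !bopBr aE opprB addrA subrK.
by apply: le_trans (MST _) _; rewrite ler_wpM2l// ltW.
Qed.

Lemma bop_eq_on_span (K : hilbertType R) A (S T : bop H K) :
  closed_span A = setT -> (forall x, A x -> S x = T x) -> S = T.
Proof.
move=> AT ST; apply: bopP => x; have : closed_span A x by rewrite AT.
exact: (closed_span_min (closed_subspace_eq S T)).
Qed.

End Theory.
End ClosedSubspaces.

Lemma ex_pos_min (F : numFieldType) (a b : F) : 0 < a -> 0 < b ->
  exists2 c, 0 < c & c <= a /\ c <= b.
Proof.
move=> a0 b0; have := real_leP (gtr0_real a0) (gtr0_real b0).
by case=> [ab|/ltW ba]; [exists a|exists b].
Qed.

Section Completeness.
Context {R : realType}.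

(** The sets [A e] generate a Cauchy filter, and [p] is its limit. The extra 1 in the constant comes
    from passing through a point of a smaller set that is within [e] of [p]. *)
Lemma complete_nested (H : hilbertType R) (A : R[i] -> set H) (k : R[i]) :
  (forall e, 0 < e -> A e !=set0) ->
  (forall e e', 0 < e -> e <= e' -> A e `<=` A e') ->
  (forall e x y, 0 < e -> A e x -> A e y -> `|x - y| <= k * e) ->
  exists p, forall e y, 0 < e -> A e y -> `|p - y| <= (k + 1) * e.
Proof.
move=> A0 Anest Adiam.
have k0 : 0 <= k.
  have [x Ax] := A0 1 ltr01; have := Adiam _ _ _ ltr01 Ax Ax.
  by rewrite subrr normr0 mulr1.
have k1 : 0 < k + 1 by rewrite ltr_wpDl.
pose F := filter_from [set e : R[i] | 0 < e] A.
have FF : ProperFilter F.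
  apply: filter_from_proper; last by move=> e; exact: A0.
  apply: filter_from_filter; first by exists 1 => /=.
  move=> a b /= a0 b0; have [c c0 [ca cb]] := ex_pos_min a0 b0.
  by exists c => // x Ax; split; exact: Anest Ax.
have [|p pF] := @hilbert_complete R H F FF.
  move=> e e0; have d0 : 0 < e / (k + 1) by rewrite divr_gt0.
  have [x Ax] := A0 _ d0; exists x; exists (e / (k + 1)) => // y Ay /=.
  apply: le_lt_trans (Adiam _ _ _ d0 Ax Ay) _.
  by rewrite mulrA ltr_pdivrMr// mulrC ltr_pM2l// ltrDl.
exists p => e y e0 Ay; have [a /= a0 Aa] := pF e e0.
have [b b0 [ba be]] := ex_pos_min a0 e0; have [z Az] := A0 _ b0.
rewrite -(subrK z p) -addrA mulrDl mul1r addrC.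
apply: le_trans (ler_normD _ _) _; rewrite lerD//.
  exact: Adiam e0 (Anest _ _ b0 be _ Az) Ay.
by apply/ltW/Aa; exact: Anest Az.
Qed.

(** The approximate preimages of [x] with error [e] form a set of diameter at most [2 c e], so they
    converge to an exact preimage. *)
Lemma closed_subspace_image (Z X : hilbertType R) (D : set Z) (L : bop Z X)
    (c : R[i]) : closed_subspace D -> 0 <= c ->
  (forall z, D z -> `|z| <= c * `|L z|) -> closed_subspace (L @` D).
Proof.
move=> sD c0 Lc; split=> [|a _ _ [z Dz <-] [w Dw <-]|x xA].
- by exists 0; [case: sD|rewrite bop0r].
- by exists (a *: z + w); [exact: subspaceP|rewrite bop_linear].
pose A e := [set z | D z /\ `|x - L z| < e].
have [||e z w e0 [Dz xz] [Dw xw]|p pA] := @complete_nested Z A (c * 2).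
- by move=> e /xA[_ [z Dz <-] xz]; exists z; split.
- by move=> e e' e0 ee' z [Dz xz]; split=> //; exact: lt_le_trans ee'.
- apply: le_trans (Lc _ (subspaceB sD Dz Dw)) _; rewrite -mulrA ler_wpM2l//.
  have -> : L (z - w) = (x - L w) - (x - L z).
    by rewrite bopBr opprB [RHS]addrC addrA subrK.
  by apply: le_trans (ler_normB _ _) _; rewrite mulr_natl mulr2n lerD ?ltW.
have c1 : 0 < c * 2 + 1 by rewrite ltr_wpDl// mulr_ge0.
have Dp : D p.
  apply: subspace_closed => // e e0.
  have d0 : 0 < e / (c * 2 + 1) / 2 by rewrite !divr_gt0.
  have [_ [z Dz <-] xz] := xA _ d0; exists z => //.
  apply: le_lt_trans (pA _ _ d0 (conj Dz xz)) _.
  by rewrite mulrA mulrCA divff ?gt_eqF// mulr1 ltr_pdivrMr// ltr_pMr// ltr1n.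
exists p => //; apply/esym/eqP; rewrite -subr_eq0 -normr_eq0; apply/eqP.
have [M M0 LM] := bop_bound_ge0 L.
apply: (@le_eps_eq0 _ (1 + M * (c * 2 + 1))) => // e e0.
have [_ [z Dz <-] xz] := xA _ e0.
have -> : x - L p = (x - L z) - L (p - z) by rewrite bopBr opprB addrA subrK.
rewrite mulrDl mul1r; apply: le_trans (ler_normB _ _) _; rewrite lerD ?(ltW xz)//.
apply: le_trans (LM _) _; rewrite -mulrA ler_wpM2l//.
exact: pA (conj Dz xz).
Qed.

Section Projection.
Context {H : hilbertType R}.
Implicit Types (D : set H).

(* A minimizing sequence for the distance is Cauchy by the parallelogram law;
   near-minimality of [y] makes [x - y] almost orthogonal to [D]. *)
Lemma orthogonal_projection D x : closed_subspace D ->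
  exists2 p, D p & forall y, D y -> <|x - p, y|> = 0.
Proof.
move=> sD; have D0 : D 0 by case: sD.
have normRe (y : H) : `|y| ^+ 2 = (complex.Re (`|y| ^+ 2))%:C%C.
  by rewrite RRe_real// ger0_real// exprn_ge0.
(* The infimum is taken in [R] and sent back to [R[i]]; squared distances are unchanged by the real
   part. *)
pose S := [set complex.Re (`|x - y| ^+ 2) | y in D].
have S0 : S !=set0 by exists (complex.Re (`|x - 0| ^+ 2)); exists 0.
have Slb : lbound S 0.
  by move=> _ [y Dy <-]; rewrite -ler0c -normRe exprn_ge0.
have Sinf : has_inf S by split=> //; exists 0.
pose m := (inf S)%:C%C.
have mle y : D y -> m <= `|x - y| ^+ 2.
  move=> Dy; rewrite normRe lecR; apply: ge_inf; first by exists 0.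
  by exists y.
(* The slack is [e ^+ 2] because the parallelogram law controls squared distances; the diameter is
   then at most [2 * e]. *)
pose A e := [set y | D y /\ `|x - y| ^+ 2 < m + e ^+ 2].
have A0 e : 0 < e -> A e !=set0.
  move=> e0; have er : e ^+ 2 = (complex.Re (e ^+ 2))%:C%C.
    by rewrite RRe_real// ger0_real// exprn_ge0// ltW.
  have [|_ [y Dy <-] xy] := @inf_adherent _ S (complex.Re (e ^+ 2)) _ Sinf.
    by rewrite -ltcR -er exprn_gt0.
  by exists y; split=> //; rewrite normRe er -rmorphD/= ltcR.
have [|e y z e0 [Dy xy] [Dz xz]|p pA] := @complete_nested H A 2 A0.
- move=> e e' e0 ee' y [Dy xy]; split=> //; apply: lt_le_trans xy _.
  by rewrite lerD2l ler_pXn2r ?nnegrE// ltW// (lt_le_trans e0).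
- rewrite -(@ler_pXn2r _ 2%N)// ?nnegrE ?mulr_ge0 ?(ltW e0)//.
  pose w := 2^-1 *: (y + z).
  have Dw : D w by apply: subspaceZ => //; exact: subspaceD.
  have := parallelogram (x - z) (x - y).
  have -> : x - z + (x - y) = 2 *: (x - w).
    rewrite scalerBr scalerA divff ?pnatr_eq0// scale1r scaler_nat mulr2n.
    by rewrite addrACA -opprD (addrC z).
  have -> : x - z - (x - y) = y - z by rewrite opprB addrC addrA subrK.
  rewrite normrZ exprMn normr_nat => E.
  have -> : `|y - z| ^+ 2 =
      2 * (`|x - z| ^+ 2 + `|x - y| ^+ 2) - 2 ^+ 2 * `|x - w| ^+ 2.
    by rewrite -E addrAC subrr add0r.
  rewrite lerBlDr; apply: (@le_trans _ _ (2 * ((m + e ^+ 2) + (m + e ^+ 2)))).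
    by rewrite ler_pM2l// lerD// ltW.
  have -> : 2 * (m + e ^+ 2 + (m + e ^+ 2)) = (2 * e) ^+ 2 + 2 ^+ 2 * m by ring.
  by rewrite lerD2l ler_wpM2l// ?exprn_ge0//; exact: mle.
have Aex e : 0 < e -> exists2 y, A e y & `|p - y| <= (2 + 1) * e.
  by move=> e0; have [y Ay] := A0 _ e0; exists y => //; exact: pA.
exists p => [|v Dv].
  apply: subspace_closed => // e e0.
  have [|y [Dy _] py] := Aex (e / 4); first by rewrite divr_gt0.
  exists y => //; apply: le_lt_trans py _.
  by rewrite mulrCA gtr_pMr// ltr_pdivrMr// mul1r -(natrD _ 2 1) ltr_nat.
apply/normr0_eq0/(@le_eps_eq0 _ (`|v| + (2 + 1) * `|v|)) => // e e0.
have [y [Dy xy] py] := Aex e e0.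
have -> : x - p = (x - y) - (p - y) by rewrite opprB addrA subrK.
rewrite innerBl mulrDl; apply: le_trans (ler_normB _ _) _; rewrite lerD//.
  rewrite mulrC -(@ler_pXn2r _ 2%N)// ?nnegrE ?mulr_ge0 ?(ltW e0)// exprMn.
  (* Used with [a = e ^+ 2]: moving [y] along [v] cannot bring the squared distance below [m], which
     it exceeds at [y] by less than [e ^+ 2]. *)
  apply: scalar_cauchy_schwarz; first by rewrite exprn_ge0.
  move=> t; have := mle _ (subspaceP sD t Dv Dy).
  rewrite (addrC _ y) opprD addrA norm2B innerZr innerZl normrZ exprMn normCK.
  rewrite -inner_conj -subr_ge0 => h.
  rewrite -(addrK m (e ^+ 2)) (addrC _ m).
  apply: le_trans h _.
  rewrite -subr_ge0; set u := (X in 0 <= X).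
  have -> : u = m + e ^+ 2 - `|x - y| ^+ 2 by rewrite /u; ring.
  by rewrite subr_ge0 ltW.
apply: le_trans (cauchy_schwarz _ _) _.
by rewrite mulrAC ler_wpM2r.
Qed.

Lemma closed_subspace_total D : closed_subspace D ->
  (forall y, (forall x, D x -> <|y, x|> = 0) -> y = 0) -> D = setT.
Proof.
move=> sD Dorth; apply/seteqP; split=> // x _.
have [p Dp /Dorth/eqP] := orthogonal_projection x sD.
by rewrite subr_eq0 => /eqP->.
Qed.

Lemma riesz (f : H -> R[i]) (M : R[i]) :
  (forall a x y, f (a *: x + y) = a * f x + f y) ->
  (forall x, `|f x| <= M * `|x|) -> exists y, forall x, f x = <|x, y|>.
Proof.
move=> flin fM.
have f0 : f 0 = 0.
  by apply/normr0_eq0/le_anti; rewrite normr_ge0 andbT; have := fM 0; rewrite normr0 mulr0.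
have [f_eq0|/existsNP[x0 fx0]] := pselect (forall x, f x = 0).
  by exists 0 => x; rewrite inner0r f_eq0.
have fB x y : f (x - y) = f x - f y by rewrite addrC -scaleN1r flin mulN1r addrC.
have sK : closed_subspace [set x | f x = 0].
  split=> [//|a x y /= xf yf|x xA] /=; first by rewrite flin xf yf mulr0 addr0.
  apply/normr0_eq0/(@le_eps_eq0 _ M) => // e /xA[a /= fa xa].
  have M0 : 0 <= M.
    have x0n0 : 0 < `|x0|.
      by rewrite normr_gt0; apply/eqP => x00; apply: fx0; rewrite x00.
    by rewrite -(pmulr_lge0 _ x0n0); apply: le_trans (fM x0).
  have -> : f x = f (x - a) by rewrite fB fa subr0.
  by apply: le_trans (fM _) _; rewrite ler_wpM2l// ltW.
have [p pK porth] := orthogonal_projection x0 sK.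
pose v := x0 - p; have fv : f v = f x0 by rewrite fB pK subr0.
have fvn0 : f v != 0 by rewrite fv; exact/eqP.
have vn0 : <|v, v|> != 0.
  by apply/eqP => /inner_eq0 v0; move: fvn0; rewrite v0 f0 eqxx.
exists ((f v / <|v, v|>)^* *: v) => x; rewrite innerZr conjCK.
have : <|v, x - (f x / f v) *: v|> = 0.
  apply: porth => /=.
  by rewrite fB -[_ *: v]addr0 flin f0 addr0 divfK// subrr.
move=> /(congr1 Num.conj); rewrite -inner_conj innerBl innerZl conjC0.
by move=> /eqP; rewrite subr_eq0 => /eqP->; field; rewrite vn0 fvn0.
Qed.

End Projection.
End Completeness.

(** * Adjoints, inverses and Gram families *)

Section OperatorConstructions.
Context {R : realType}.

(** Single-valuedness makes the chosen function linear. Adjoints, inverses and Gram contractions are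
    all obtained from their specifications in this way. *)
Lemma bop_of_rel (X Y : hilbertType R) (G : X -> Y -> Prop) (M : R[i]) :
  (forall x, exists y, G x y) ->
  (forall x y z, G x y -> G x z -> y = z) ->
  (forall a x y x' y', G x y -> G x' y' -> G (a *: x + x') (a *: y + y')) ->
  (forall x y, G x y -> `|y| <= M * `|x|) ->
  exists T : bop X Y, forall x, G x (T x).
Proof.
move=> /choice[f Gf] Guniq Glin Gle.
have fb : f \in @bounded_op R X Y.
  apply/bounded_opP; split=> [a x y|]; last by exists M => x; exact: Gle.
  by apply: Guniq (Gf _) _; exact: Glin.
by exists (Bop fb).
Qed.

Section Adjoint.
Context {X Y : hilbertType R}.
Implicit Types T : bop X Y.

Lemma is_adjoint_uniq T (S S' : bop Y X) :
  is_adjoint T S -> is_adjoint T S' -> S = S'.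
Proof.
move=> TS TS'; apply: bopP => y; apply: inner_inj => x.
by rewrite inner_conj -TS TS' -inner_conj.
Qed.

(** [adj T y] is the Riesz vector [x] of [z |-> <|T z, y|>]; its bound comes from
    [|x|^2 = <|T x, y|> <= M |x| |y|]. *)
Lemma is_adjoint_adj T : is_adjoint T (adj T).
Proof.
suff [S TS] : exists S : bop Y X, is_adjoint T S by apply: xgetI TS.
have [M M0 TM] := bop_bound_ge0 T.
have [||||S TS] := @bop_of_rel Y X (fun y x => forall z, <|T z, y|> = <|z, x|>) M.
- move=> y; apply: (@riesz _ _ (fun z => <|T z, y|>) (M * `|y|)) => [a u v|z].
    by rewrite bop_linear innerDl innerZl.
  by apply: le_trans (cauchy_schwarz _ _) _; rewrite mulrAC ler_wpM2r.
- move=> y x x' yx yx'; apply: inner_inj => z.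
  by rewrite inner_conj -yx yx' -inner_conj.
- by move=> a y x y' x' yx yx' z; rewrite !innerDr !innerZr yx yx'.
- move=> y x yx; have [x0|xn0] := eqVneq `|x| 0.
    by rewrite x0 mulr_ge0.
  have x0 : 0 < `|x| by rewrite lt_def xn0/=.
  rewrite -(ler_pM2r x0) -expr2 -inner_norm -yx.
  have : 0 <= <|T x, y|> by rewrite yx inner_ge0.
  move=> /ger0_norm <-; apply: le_trans (cauchy_schwarz _ _) _.
  by rewrite mulrAC ler_wpM2r.
- by exists S => z y; rewrite TS.
Qed.

Lemma adjE T x y : <|x, adj T y|> = <|T x, y|>.
Proof. by rewrite is_adjoint_adj. Qed.

Lemma adjEl T x y : <|adj T y, x|> = <|y, T x|>.
Proof. by rewrite inner_conj adjE -inner_conj. Qed.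

Lemma adj_uniq T S : is_adjoint T S -> adj T = S.
Proof. exact: is_adjoint_uniq (is_adjoint_adj T). Qed.

End Adjoint.

Lemma adj_comp (X Y Z : hilbertType R) (S : bop Y Z) (T : bop X Y) :
  adj (S \oB T) = adj T \oB adj S.
Proof. by apply: adj_uniq => x z; rewrite /= !adjE. Qed.

Lemma adj_id (X : hilbertType R) : adj (bop_id X) = bop_id X.
Proof. by apply: adj_uniq. Qed.

Lemma adjB (X Y : hilbertType R) (S T : bop X Y) : adj (S - T) = adj S - adj T.
Proof.
by apply: adj_uniq => x y; rewrite !bopDE !bopNE innerBl innerBr !adjE.
Qed.

Lemma is_inverse_uniq (X Y : hilbertType R) (T : bop X Y) (S S' : bop Y X) :
  is_inverse T S -> is_inverse T S' -> S = S'.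
Proof.
move=> [ST _] [_ TS']; apply: bopP => y.
have := congr1 (fun V : bop Y Y => V y) TS' => /= {1}<-.
exact: (congr1 (fun V : bop X X => V (S' y)) ST).
Qed.

Lemma bop_inv_uniq (X Y : hilbertType R) (T : bop X Y) (S : bop Y X) :
  is_inverse T S -> bop_inv T = S.
Proof. by move=> TS; apply: is_inverse_uniq (TS); apply: xgetI TS. Qed.

(* [I - T] is bounded below, and its range has trivial orthogonal complement. *)
Lemma invertible_id_sub (X : hilbertType R) (T : bop X X) (r : R[i]) :
  0 <= r -> r < 1 -> (forall x, `|T x| <= r * `|x|) ->
  is_inverse (bop_id X - T) (bop_inv (bop_id X - T)).
Proof.
move=> r0 r1 Tr; set L := bop_id X - T.
have LE x : L x = x - T x by [].
have r10 : 0 < 1 - r by rewrite subr_gt0.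
have Lge x : `|x| <= (1 - r)^-1 * `|L x|.
  rewrite mulrC ler_pdivlMr// mulrBr mulr1 LE lerBlDr.
  rewrite -{1}(subrK (T x) x); apply: le_trans (ler_normD _ _) _.
  by rewrite lerD2l mulrC.
have r1V : 0 <= (1 - r)^-1 by rewrite invr_ge0 ltW.
have sT : closed_subspace (@setT X) by split.
have Lsurj : L @` setT = setT.
  apply: closed_subspace_total => [|y yL].
    by apply: closed_subspace_image sT r1V _ => z _; exact: Lge.
  (* A vector orthogonal to the range is tested against its own image:
     [|y|^2 = <|y, T y|> <= r |y|^2] with [r < 1]. *)
  have : <|y, L y|> = 0 by apply: yL; exists y.
  rewrite LE innerBr => /eqP; rewrite subr_eq0 inner_norm => /eqP yT.
  apply/eqP; rewrite -normr_eq0; apply: contraT => yn0.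
  have y0 : 0 < `|y| by rewrite lt_def yn0/=.
  have : `|y| ^+ 2 <= r * `|y| ^+ 2.
    rewrite {1}yT -(ger0_norm (_ : 0 <= <|y, T y|>)).
      apply: le_trans (cauchy_schwarz _ _) _.
      by rewrite mulrC expr2 mulrA ler_wpM2r.
    by rewrite -yT exprn_ge0.
  rewrite ler_pMl ?exprn_gt0// => /(lt_le_trans r1).
  by rewrite ltxx.
have [||||S LS] := @bop_of_rel X X (fun y x => L x = y) (1 - r)^-1.
- move=> y; have [x _ <-] : (L @` setT) y by rewrite Lsurj.
  by exists x.
- move=> y x x' <- /eqP; rewrite -subr_eq0 -bopBr => /eqP Lxx.
  apply/esym/eqP; rewrite -subr_eq0 -normr_le0.
  by apply: le_trans (Lge _) _; rewrite Lxx normr0 mulr0.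
- by move=> a y x y' x' <- <-; rewrite bop_linear.
- by move=> y x <-; exact: Lge.
suff LI : is_inverse L S by rewrite (bop_inv_uniq LI).
split; apply: bopP => x /=; last exact: LS.
apply/eqP; rewrite -subr_eq0 -normr_le0.
by apply: le_trans (Lge _) _; rewrite bopBr LS subrr normr0 mulr0.
Qed.

(* [T] acts on the closed span of [g] through the closed span of the graph
   [(g i, h i)] and vanishes on its orthogonal complement. *)
Lemma gram_contraction (X Y : hilbertType R) (I : Type) (g : I -> X) (h : I -> Y) :
  (forall i j, <|g i, g j|> = <|h i, h j|>) ->
  exists T : bop X Y, [/\ forall i, T (g i) = h i, contractive T &
    isometric_on (closed_span (range g)) T].
Proof.
move=> gh; pose Z := hsum X Y.
pose k i : Z := (g i, h i).
pose Gr := closed_span (range k).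
have sGr : closed_subspace Gr by exact: closed_span_subspace.
have Grk z i : Gr z -> <|z.1, g i|> = <|z.2, h i|>.
  (* The sign turns equality of two inner products into orthogonality to one vector, a closed
     condition that need only be checked on generators. *)
  move=> Grz; pose w : Z := (g i, - h i).
  suff : <|z, w|> = 0.
    by rewrite hsum_innerE/= innerNr => /eqP; rewrite subr_eq0 => /eqP.
  move: z Grz; apply: closed_span_min; first exact: (closed_subspace_orth w).
  by move=> _ [j _ <-] /=; rewrite hsum_innerE/= innerNr gh subrr.
have Grin z w : Gr z -> Gr w -> <|z.1, w.1|> = <|z.2, w.2|>.
  move=> Grz Grw; pose z' : Z := (z.1, - z.2).
  suff : <|w, z'|> = 0.
    move=> /(congr1 Num.conj); rewrite conjC0 -inner_conj hsum_innerE/= innerNl.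
    by move=> /eqP; rewrite subr_eq0 => /eqP.
  move: w Grw; apply: closed_span_min; first exact: (closed_subspace_orth z').
  move=> _ [j _ <-] /=; rewrite inner_conj hsum_innerE/= innerNl Grk// subrr.
  exact: conjC0.
have Grnorm z : Gr z -> `|z.1| = `|z.2|.
  by move=> Grz; rewrite -!sqrtC_inner Grin.
have fstb : (fun z : Z => z.1) \in @bounded_op R Z X.
  apply/bounded_opP; split=> //; exists 1 => z; rewrite mul1r.
  exact: hsum_fst_le.
pose P1 : bop Z X := Bop fstb.
(* Both components of a graph element have the same norm, so [P1] is bounded below on the graph; its
   closed image then admits an orthogonal projection. *)
have sP : closed_subspace (P1 @` Gr).
  apply: (closed_subspace_image sGr (ler0n _ 2)) => z Grz.
  apply: le_trans (hsum_norm_le_sum _) _.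
  by rewrite -(Grnorm _ Grz) mulr_natl mulr2n.
have spanP : closed_span (range g) `<=` P1 @` Gr.
  apply: closed_span_min => // _ [i _ <-]; exists (k i) => //.
  by apply: sub_closed_span; exists i.
(* [p] is the orthogonal projection of [x] onto the image of [P1], and [y] is the second component
   of the graph element above [p]. *)
pose Rel x y := exists2 p, Gr (p, y) & forall z, Gr z -> <|x - p, z.1|> = 0.
have Relp x p p' y y' : Gr (p, y) -> (forall z, Gr z -> <|x - p, z.1|> = 0) ->
    Gr (p', y') -> (forall z, Gr z -> <|x - p', z.1|> = 0) -> p = p' /\ y = y'.
  move=> Gp xp Gp' xp'.
  have G0 : Gr (((p, y) : Z) - ((p', y') : Z)) by exact: (subspaceB sGr Gp Gp').
  have pp : p - p' = 0.
    apply: inner_eq0.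
    have {1}-> : p - p' = (x - p') - (x - p) by rewrite opprB [RHS]addrC addrA subrK.
    by rewrite innerBl (xp _ G0) (xp' _ G0) subrr.
  split; apply/eqP; rewrite -subr_eq0; first by rewrite pp.
  by rewrite -normr_eq0 -(Grnorm _ G0)/= pp normr0.
have Relle x y : Rel x y -> `|y| <= 1 * `|x|.
  move=> [p Gp xp]; rewrite mul1r -(Grnorm _ Gp)/=.
  rewrite -(@ler_pXn2r _ 2%N)// ?nnegrE// -[in leRHS](subrK p x) norm2D.
  rewrite (xp _ Gp) inner_conj (xp _ Gp) conjC0 !addr0 lerDr.
  exact: exprn_ge0.
have [||||T RT] := @bop_of_rel X Y Rel 1.
- move=> x; have [_ [z Gz <-] xz] := orthogonal_projection x sP.
  exists z.2; exists z.1; first by rewrite -surjective_pairing.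
  by move=> w Gw; apply: xz; exists w.
- by move=> x y y' [p Gp xp] [p' Gp' xp']; have [] := Relp _ _ _ _ _ Gp xp Gp' xp'.
- move=> a x y x' y' [p Gp xp] [p' Gp' xp']; exists (a *: p + p').
    exact: (subspaceP sGr a Gp Gp').
  move=> z Gz; have -> : a *: x + x' - (a *: p + p') = a *: (x - p) + (x' - p').
    by rewrite opprD addrACA scalerBr.
  by rewrite innerDl innerZl xp// xp'// mulr0 addr0.
- exact: Relle.
have TGr z : Gr z -> T z.1 = z.2.
  move=> Gz; have [p Gp zp] := RT z.1.
  have [//||_ ->//] := Relp z.1 p z.1 (T z.1) z.2 Gp zp.
    by rewrite -surjective_pairing.
  by move=> w _; rewrite subrr inner0l.
exists T; split=> [i|x|x /spanP[z Gz <-]].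
- by rewrite (TGr (k i))//; apply: sub_closed_span; exists i.
- by have := Relle _ _ (RT x); rewrite mul1r.
- by rewrite TGr// (Grnorm _ Gz).
Qed.

End OperatorConstructions.

(** * Reproducing kernel Hilbert spaces *)

Section ScalarLimits.
Context {R : realType}.

Lemma ge0_eps (c k : R[i]) :
  (forall e, 0 < e -> exists2 r, 0 <= r & `|c - r| <= k * e) -> 0 <= c.
Proof.
move=> ck; suff -> : c = `|c| by [].
apply/eqP; rewrite eq_sym -subr_eq0 -normr_eq0; apply/eqP.
apply: (@le_eps_eq0 _ (k + k)) => // e /ck[r r0 cr].
have -> : `|c| - c = (`|c| - `|r|) - (c - r) by rewrite (ger0_norm r0); ring.
apply: le_trans (ler_normB _ _) _; rewrite mulrDl lerD//.
exact: le_trans (ler_dist_dist _ _) cr.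
Qed.

Lemma le_eps (a b k : R[i]) : a \is Num.real -> b \is Num.real ->
  (forall e, 0 < e -> a <= b + k * e) -> a <= b.
Proof.
move=> ar br abk; have [//|ba] := real_leP ar br.
have ab0 : 0 < a - b by rewrite subr_gt0.
suff abE : a - b = 0 by rewrite abE ltxx in ab0.
apply: (@le_eps_eq0 _ k); first exact: ltW.
by move=> e e0; rewrite lerBlDl abk.
Qed.

(** The limit is the supremum of the lower estimates [f x - k e]; nestedness makes each [f x + k e]
    an upper bound of them. *)
Lemma real_nested (T : Type) (A : R[i] -> set T) (f : T -> R) (k : R) :
  (forall e, 0 < e -> A e !=set0) ->
  (forall e e', 0 < e -> e <= e' -> A e `<=` A e') ->
  (forall e x y, 0 < e -> A e x -> A e y -> `|f x - f y| <= k * complex.Re e) ->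
  exists c, forall e x, 0 < e -> A e x -> `|c - f x| <= k * complex.Re e.
Proof.
move=> A0 Anest Af.
pose S := [set r | exists e x, [/\ 0 < e, A e x & r = f x - k * complex.Re e]].
have Sle e x : 0 < e -> A e x -> ubound S (f x + k * complex.Re e).
  move=> e0 Ax _ [e' [y [e'0 Ay ->]]].
  have le0 a z t : 0 < a -> A a z -> A a t -> f z - f t <= k * complex.Re a.
    by move=> a0 Az At; apply: le_trans (ler_norm _) (Af _ _ _ a0 Az At).
  have k0 a : 0 < a -> 0 <= k * complex.Re a.
    by move=> a0; have [z Az] := A0 _ a0; have := le0 _ _ _ a0 Az Az; rewrite subrr.
  have := real_leP (gtr0_real e0) (gtr0_real e'0); case=> [ee'|/ltW e'e].
    have := le0 _ _ _ e'0 Ay (Anest _ _ e0 ee' _ Ax).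
    by have := k0 _ e0; lra.
  have := le0 _ _ _ e0 (Anest _ _ e'0 e'e _ Ay) Ax.
  by have := k0 _ e'0; lra.
have S0 : S !=set0.
  by have [x Ax] := A0 1 ltr01; exists (f x - k * complex.Re 1), 1, x.
have Ssup : has_sup S.
  by split=> //; have [x Ax] := A0 1 ltr01; exists (f x + k * complex.Re 1); exact: Sle.
exists (sup S) => e x e0 Ax; rewrite ler_distl; apply/andP; split.
  by apply: ub_le_sup; [case: Ssup|exists e, x].
by apply: ge_sup => //; exact: Sle.
Qed.

(** Real and imaginary parts converge separately, and adding their errors produces the factor 2. *)
Lemma complex_nested (T : Type) (A : R[i] -> set T) (f : T -> R[i]) (k : R[i]) :
  (forall e, 0 < e -> A e !=set0) ->
  (forall e e', 0 < e -> e <= e' -> A e `<=` A e') ->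
  (forall e x y, 0 < e -> A e x -> A e y -> `|f x - f y| <= k * e) ->
  exists c, forall e x, 0 < e -> A e x -> `|c - f x| <= k * 2 * e.
Proof.
move=> A0 Anest Af.
have k0 : 0 <= k.
  have [x Ax] := A0 1 ltr01; have := Af _ _ _ ltr01 Ax Ax.
  by rewrite subrr normr0 mulr1.
have ReP (a : R[i]) : 0 <= a -> a = (complex.Re a)%:C%C.
  by move=> a0; rewrite RRe_real// ger0_real.
have keE e : 0 < e -> k * e = (complex.Re k * complex.Re e)%:C%C.
  by move=> e0; rewrite rmorphM/= -!ReP// ltW.
have ReLe (z : R[i]) : `|complex.Re z|%:C%C <= `|z|.
  rewrite normc_def lecR -sqrtr_sqr ler_wsqrtr// lerDl.
  exact: sqr_ge0.
have ImLe (z : R[i]) : `|complex.Im z|%:C%C <= `|z|.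
  rewrite normc_def lecR -sqrtr_sqr ler_wsqrtr// lerDr.
  exact: sqr_ge0.
have [e x y e0 Ax Ay|c cA] :=
    @real_nested T A (fun x => complex.Re (f x)) (complex.Re k) A0 Anest.
  rewrite -lecR -keE//; apply: le_trans (Af _ _ _ e0 Ax Ay).
  by have := ReLe (f x - f y); case: (f x) (f y) => [? ?] [? ?].
have [e x y e0 Ax Ay|c' cA'] :=
    @real_nested T A (fun x => complex.Im (f x)) (complex.Re k) A0 Anest.
  rewrite -lecR -keE//; apply: le_trans (Af _ _ _ e0 Ax Ay).
  by have := ImLe (f x - f y); case: (f x) (f y) => [? ?] [? ?].
exists (Complex c c') => e x e0 Ax.
have := cA _ _ e0 Ax; have := cA' _ _ e0 Ax.
rewrite -!lecR -!keE// mulrAC mulr_natr mulr2n => h' h.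
apply: le_trans (lerD h h').
case: (f x) => a b /=; rewrite [Complex c c' - _]complexE.
apply: le_trans (ler_normD _ _) _; rewrite normrM.
by rewrite !normc_def/= expr0n/= !addr0 add0r expr1n sqrtr1 rmorph1 mul1r !sqrtr_sqr.
Qed.

End ScalarLimits.

Section MooreAronszajn.
Context (R : realType) (W : Type) (E : hilbertType R) (K : W -> W -> bop E E).
Hypothesis Kpos : positive_kernel K.
Local Notation C := R[i].
Implicit Types (f g : W -> E) (x y : seq (W * E)).

(* A list [x] of pairs [(w, c)] stands for the finite combination [kcomb x] of
   the functions [K(., w) c], and [pairing f x] for the value that the inner
   product [<f, kcomb x>] must have. *)
Definition kcomb x : W -> E := fun z => \sum_(p <- x) K z p.1 p.2.

Definition pairing f x : C := \sum_(p <- x) <|f p.1, p.2|>.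

Definition scale_comb (a : C) x := [seq (p.1, a *: p.2) | p <- x].

Lemma pairing_cat f x y : pairing f (x ++ y) = pairing f x + pairing f y.
Proof. exact: big_cat. Qed.

Lemma pairing_scale f a x : pairing f (scale_comb a x) = a^* * pairing f x.
Proof.
rewrite /pairing big_map mulr_sumr; apply: eq_bigr => p _; exact: innerZr.
Qed.

Lemma pairingP a f g x : pairing (a *: f + g) x = a * pairing f x + pairing g x.
Proof.
rewrite /pairing mulr_sumr -big_split /=; apply: eq_bigr => p _.
by rewrite -innerZl -innerDl.
Qed.

Lemma pairingD f g x : pairing (f + g) x = pairing f x + pairing g x.
Proof. by have := pairingP 1 f g x; rewrite scale1r mul1r. Qed.

Lemma pairingB f g x : pairing (f - g) x = pairing f x - pairing g x.
Proof.
have := pairingP (-1) g f x; rewrite scaleN1r mulN1r addrC => ->.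
by rewrite addrC.
Qed.

Lemma kcomb_cat x y : kcomb (x ++ y) = kcomb x + kcomb y.
Proof. by apply/funext => z; exact: big_cat. Qed.

Lemma kcomb_scale a x : kcomb (scale_comb a x) = a *: kcomb x.
Proof.
apply/funext => z; rewrite /kcomb big_map.
transitivity (a *: \sum_(p <- x) K z p.1 p.2) => //.
by rewrite scaler_sumr; apply: eq_bigr => p _; rewrite bopZr.
Qed.

Definition kform x y := pairing (kcomb x) y.

Lemma kform_catl x x' y : kform (x ++ x') y = kform x y + kform x' y.
Proof. by rewrite /kform kcomb_cat pairingD. Qed.

Lemma kform_scalel a x y : kform (scale_comb a x) y = a * kform x y.
Proof.
rewrite /kform kcomb_scale -[a *: _]addr0 pairingP -[RHS]addr0; congr (_ + _).
by rewrite /pairing big1// => p _; exact: inner0l.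
Qed.

Lemma kform_ge0 x : 0 <= kform x x.
Proof.
have := Kpos (fun i => (tnth (in_tuple x) i).1) (fun i => (tnth (in_tuple x) i).2).
set u := (X in 0 <= X -> _); suff -> : kform x x = u by [].
rewrite /kform /pairing big_tnth; apply: eq_bigr => i _.
by rewrite /kcomb big_tnth inner_suml.
Qed.

(** Hermitian symmetry is a consequence of positivity over the complex field: the form is real on
    the diagonal, and this is tested on [x + y] and on [x + 'i y]. *)
Lemma kform_conj x y : kform y x = (kform x y)^*.
Proof.
have real2 z z' : (kform z z' + kform z' z)^* = kform z z' + kform z' z.
  have := ger0_real (kform_ge0 (z ++ z')).
  rewrite kform_catl {1 2}/kform !pairing_cat -!/(kform _ _).
  set a := kform z z; set b := kform z' z'; set u := kform z z'; set v := kform z' z.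
  have -> : a + u + (v + b) = (a + b) + (u + v) by ring.
  rewrite rpredDl; last by rewrite rpredD// ger0_real// kform_ge0.
  by move=> /CrealP.
have h1 := real2 x y; have := real2 x (scale_comb 'i y).
rewrite kform_scalel /kform pairing_scale -!/(kform _ _) conjCi.
move: h1; rewrite !rmorphD !rmorphM rmorphN /= conjCi.
set u := kform x y; set v := kform y x => h1 h2.
have i2 : 'i * 'i = -1 :> C by rewrite -expr2 sqrCi.
have h3 : u^* - v^* = v - u.
  have -> : u^* - v^* = - 'i * (- - 'i * u^* + - 'i * v^*).
    rewrite opprK mulrDr mulNr !mulNr mulrN !mulrA i2; ring.
  by rewrite h2 mulrDr !mulNr !mulrN !mulrA i2; ring.
have : v *+ 2 = u^* *+ 2.
  have -> : v *+ 2 = (u + v) + (v - u) by ring.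
  by rewrite -h1 -h3; ring.
by move=> /eqP; rewrite eqrMn2r => /eqP.
Qed.

Definition knorm x := sqrtC (kform x x).

Lemma knorm_ge0 x : 0 <= knorm x. Proof. by rewrite sqrtC_ge0 kform_ge0. Qed.

Lemma knorm_sqr x : knorm x ^+ 2 = kform x x. Proof. exact: sqrtCK. Qed.

Lemma kform_le x y : `|kform x y| <= knorm x * knorm y.
Proof.
rewrite -(@ler_pXn2r _ 2%N)// ?nnegrE ?mulr_ge0 ?knorm_ge0// exprMn !knorm_sqr.
apply: scalar_cauchy_schwarz; first exact: kform_ge0.
move=> t; have := kform_ge0 (x ++ scale_comb (- t) y).
rewrite !kform_catl !kform_scalel /kform !pairing_cat !pairing_scale.
rewrite -!/(kform _ _) -kform_conj rmorphN/=.
set u := (X in 0 <= X -> _); set v := (X in _ -> 0 <= X).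
by have -> : u = v by rewrite /u /v; ring.
Qed.

(** The criterion for [M] to bound the norm of [f] in the space under construction: pairing with [f]
    is a functional of norm at most [M] on the finite combinations. *)
Definition fbound f (M : C) := forall y, `|pairing f y| <= M * knorm y.

Lemma fbound_kcomb x : fbound (kcomb x) (knorm x).
Proof. by move=> y; exact: kform_le. Qed.

Lemma fboundP a f g M N : fbound f M -> fbound g N ->
  fbound (a *: f + g) (`|a| * M + N).
Proof.
move=> fM gN y; rewrite pairingP mulrDl -mulrA.
apply: le_trans (ler_normD _ _) _.
by rewrite lerD// normrM ler_wpM2l.
Qed.

Lemma fboundD f g M N : fbound f M -> fbound g N -> fbound (f + g) (M + N).
Proof.
by move=> fM gN; have := fboundP 1 fM gN; rewrite scale1r normr1 mul1r.
Qed.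

Lemma fboundB f g M N : fbound f M -> fbound g N -> fbound (f - g) (M + N).
Proof.
move=> fM gN; have := fboundP (-1) gN fM.
by rewrite scaleN1r normrN1 mul1r addrC [N + M]addrC.
Qed.

Lemma fboundW f M N : M <= N -> fbound f M -> fbound f N.
Proof. by move=> MN fM y; apply: le_trans (fM y) _; rewrite ler_wpM2r// knorm_ge0. Qed.

Lemma fbound_sub f g h M N : fbound (f - g) M -> fbound (g - h) N ->
  fbound (f - h) (M + N).
Proof. by move=> fg gh; have := fboundD fg gh; rewrite addrA subrK. Qed.

Lemma fbound_subC f g M : fbound (f - g) M -> fbound (g - f) M.
Proof. by move=> fg y; rewrite pairingB distrC -pairingB. Qed.

Lemma knorm_le x M : 0 <= M -> fbound (kcomb x) M -> knorm x <= M.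
Proof.
move=> M0 xM; have [->//|xn0] := eqVneq (knorm x) 0.
have x0 : 0 < knorm x by rewrite lt_def xn0 knorm_ge0.
rewrite -(ler_pM2r x0) -expr2 knorm_sqr -(ger0_norm (kform_ge0 x)).
exact: xM.
Qed.

Lemma kcombB x y : kcomb (x ++ scale_comb (-1) y) = kcomb x - kcomb y.
Proof. by rewrite kcomb_cat kcomb_scale scaleN1r. Qed.

Lemma pairing_sub_le f M x y e : fbound f M -> 0 <= M -> 0 <= e ->
  fbound (kcomb x - kcomb y) e -> `|pairing f x - pairing f y| <= M * e.
Proof.
move=> fM M0 e0 xy.
have -> : pairing f x - pairing f y = pairing f (x ++ scale_comb (-1) y).
  by rewrite pairing_cat pairing_scale rmorphN1 mulN1r.
apply: le_trans (fM _) _; rewrite ler_wpM2l//; apply: knorm_le => //.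
by rewrite kcombB.
Qed.

Definition rk_pred : pred (W -> E) :=
  fun f => `[< forall e : C, 0 < e -> exists x, fbound (f - kcomb x) e >].

Lemma rk_predP f : reflect
  (forall e : C, 0 < e -> exists x, fbound (f - kcomb x) e) (f \in rk_pred).
Proof. exact: asboolP. Qed.

Lemma kcomb_rk_pred x : kcomb x \in rk_pred.
Proof.
apply/rk_predP => e e0; exists x => y; rewrite pairingB subrr normr0.
by rewrite mulr_ge0 ?knorm_ge0// ltW.
Qed.

Lemma rk_pred_bound f : f \in rk_pred -> exists2 M, 0 <= M & fbound f M.
Proof.
move=> /rk_predP/(_ 1 ltr01)[x fx]; exists (1 + knorm x).
  by rewrite addr_ge0// knorm_ge0.
by have := fboundD fx (fbound_kcomb x); rewrite subrK.
Qed.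

Fact rk_pred_submod : GRing.submod_closed rk_pred.
Proof.
split=> [|a f g /rk_predP fP /rk_predP gP].
  have := kcomb_rk_pred [::]; suff -> : kcomb [::] = 0 by [].
  by apply/funext => z; rewrite /kcomb big_nil.
apply/rk_predP => e e0; have a1 : 0 < `|a| + 1 by rewrite ltr_wpDl.
have [x fx] := fP (e / 2 / (`|a| + 1)) (divr_gt0 (divr_gt0 e0 (ltr0Sn _ 1)) a1).
have [y gy] := gP (e / 2) (divr_gt0 e0 (ltr0Sn _ 1)).
exists (scale_comb a x ++ y); rewrite kcomb_cat kcomb_scale.
have -> : a *: f + g - (a *: kcomb x + kcomb y) = a *: (f - kcomb x) + (g - kcomb y).
  by rewrite opprD addrACA scalerBr.
apply: fboundW (fboundP a fx gy); rewrite [leRHS](splitr e) lerD2r.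
rewrite mulrA ler_pdivrMr// mulrC ler_pM2l ?divr_gt0//.
by rewrite lerDl.
Qed.

Lemma rk_pred_linear a f g :
  f \in rk_pred -> g \in rk_pred -> a *: f + g \in rk_pred.
Proof. by case: rk_pred_submod => _ lin; exact: lin. Qed.

(* [c] is the limit of [pairing f y] as [kcomb y] tends to [g]. *)
Definition is_ip f g (c : C) := exists k : C, forall e y, 0 < e ->
  fbound (g - kcomb y) e -> `|c - pairing f y| <= k * e.

Lemma is_ip_ex f g : f \in rk_pred -> g \in rk_pred -> exists c, is_ip f g c.
Proof.
move=> /rk_pred_bound[M M0 fM] /rk_predP gP.
have [||e x y e0 gx gy|c cP] := @complex_nested R _
    (fun e => [set y | fbound (g - kcomb y) e]) (pairing f) (M * 2).
- by move=> e /gP[x gx]; exists x.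
- by move=> e e' e0 ee' x; exact: fboundW.
- rewrite -mulrA; apply: pairing_sub_le => //; first by rewrite mulr_ge0// ltW.
  by rewrite mulr_natl mulr2n; apply: fbound_sub (fbound_subC gx) gy.
by exists c, (M * 2 * 2) => e y e0; exact: cP.
Qed.

Lemma is_ip_uniq f g c c' : g \in rk_pred -> is_ip f g c -> is_ip f g c' -> c = c'.
Proof.
move=> /rk_predP gP [k ck] [k' ck']; apply/eqP; rewrite -subr_eq0 -normr_eq0; apply/eqP.
apply: (@le_eps_eq0 _ (k + k')) => // e e0; have [y gy] := gP e e0.
have -> : c - c' = (c - pairing f y) - (c' - pairing f y) by ring.
by apply: le_trans (ler_normB _ _) _; rewrite mulrDl lerD ?ck ?ck'.
Qed.

Definition ip f g := xget 0 [set c | is_ip f g c].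

Lemma ipP f g : f \in rk_pred -> g \in rk_pred -> is_ip f g (ip f g).
Proof. by move=> fP gP; have [c fgc] := is_ip_ex fP gP; apply: xgetI fgc. Qed.

Lemma ip_eq f g c : f \in rk_pred -> g \in rk_pred -> is_ip f g c -> ip f g = c.
Proof. by move=> fP gP fgc; apply: (is_ip_uniq gP _ fgc); exact: ipP. Qed.

Lemma is_ip_linear a f g h c c' : is_ip f h c -> is_ip g h c' ->
  is_ip (a *: f + g) h (a * c + c').
Proof.
move=> [k ck] [k' ck']; exists (`|a| * k + k') => e y e0 hy; rewrite pairingP.
have -> : a * c + c' - (a * pairing f y + pairing g y) =
    a * (c - pairing f y) + (c' - pairing g y) by ring.
apply: le_trans (ler_normD _ _) _; rewrite mulrDl -mulrA lerD ?ck'//.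
by rewrite normrM ler_wpM2l// ck.
Qed.

Lemma is_ip_conj f g c : f \in rk_pred -> g \in rk_pred ->
  is_ip f g c -> is_ip g f c^*.
Proof.
move=> fP gP [k ck]; have [M M0 gM] := rk_pred_bound gP.
exists (`|k| + (M + 1) + 1) => e x e0 fx.
have k1 : 0 < knorm x + 1 by rewrite ltr_wpDl// knorm_ge0.
(* The approximation [y] of [g] is chosen after [x]: [d <= 1] keeps [knorm y] below [M + 1], and
   [d <= e / (knorm x + 1)] absorbs the norm of [x]. *)
have [d' d'0 [d'e d'1]] := ex_pos_min e0 ltr01.
have [d d0 [dd' dx]] := ex_pos_min d'0 (divr_gt0 e0 k1).
have [y gy] := (rk_predP _ gP) d d0.
have de := le_trans dd' d'e; have d1 := le_trans dd' d'1.
have -> : c^* - pairing g x =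
    (c - pairing f y)^* + ((pairing (f - kcomb x) y)^* - pairing (g - kcomb y) x).
  rewrite !pairingB -!/(kform _ _) !rmorphB/= -kform_conj; ring.
have h1 : `|(c - pairing f y)^*| <= `|k| * e.
  rewrite norm_conjC; apply: le_trans (ck _ _ d0 gy) _.
  have k0 : 0 <= k.
    by rewrite -(pmulr_lge0 _ d0); apply: le_trans (ck _ _ d0 gy).
  by rewrite ger0_norm// ler_wpM2l.
have h2 : `|(pairing (f - kcomb x) y)^*| <= (M + 1) * e.
  rewrite norm_conjC; apply: le_trans (fx y) _; rewrite mulrC ler_wpM2r ?(ltW e0)//.
  apply: knorm_le; first by rewrite addr_ge0.
  have -> : kcomb y = g - (g - kcomb y) by rewrite opprB addrC subrK.
  by apply: fboundW (fboundB gM gy); rewrite lerD2l.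
have h3 : `|pairing (g - kcomb y) x| <= e.
  apply: le_trans (gy x) _; apply: (@le_trans _ _ (d * (knorm x + 1))).
    by rewrite ler_wpM2l ?(ltW d0)// lerDl.
  by rewrite -ler_pdivlMr.
apply: le_trans (ler_normD _ _) _.
have -> : (`|k| + (M + 1) + 1) * e = `|k| * e + ((M + 1) * e + e) by ring.
by rewrite lerD//; apply: le_trans (ler_normB _ _) _; exact: lerD.
Qed.

Lemma ip_linear a f g h : f \in rk_pred -> g \in rk_pred -> h \in rk_pred ->
  ip (a *: f + g) h = a * ip f h + ip g h.
Proof.
move=> fP gP hP; apply: ip_eq => //; last by apply: is_ip_linear; exact: ipP.
by exact: rk_pred_linear.
Qed.

Lemma ip_conjC f g : f \in rk_pred -> g \in rk_pred -> ip g f = (ip f g)^*.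
Proof. by move=> fP gP; apply: ip_eq => //; apply: is_ip_conj => //; exact: ipP. Qed.

Lemma ip_kcomb f x : f \in rk_pred -> ip f (kcomb x) = pairing f x.
Proof.
move=> fP; have [M M0 fM] := rk_pred_bound fP.
apply: ip_eq => //; first exact: kcomb_rk_pred.
by exists M => e y e0; apply: pairing_sub_le => //; exact: ltW.
Qed.

Lemma ip_self_ge0 f : f \in rk_pred -> 0 <= ip f f.
Proof.
move=> fP; have [M M0 fM] := rk_pred_bound fP; have [k fk] := ipP fP fP.
apply: (@ge0_eps _ _ (`|k| + (M + 1))) => e e0.
have [d d0 [de d1]] := ex_pos_min e0 ltr01.
have [y fy] := (rk_predP _ fP) d d0; exists (kform y y); first exact: kform_ge0.
have -> : ip f f - kform y y = (ip f f - pairing f y) + pairing (f - kcomb y) y.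
  by rewrite pairingB -/(kform _ _); ring.
apply: le_trans (ler_normD _ _) _; rewrite mulrDl lerD//.
  apply: le_trans (fk _ _ d0 fy) _.
  have k0 : 0 <= k.
    by rewrite -(pmulr_lge0 _ d0); apply: le_trans (fk _ _ d0 fy).
  by rewrite ger0_norm// ler_wpM2l.
apply: le_trans (fy y) _.
rewrite mulrC ler_pM ?knorm_ge0 ?(ltW d0)//.
apply: knorm_le; first by rewrite addr_ge0.
have -> : kcomb y = f - (f - kcomb y) by rewrite opprB addrC subrK.
by apply: fboundW (fboundB fM fy); rewrite lerD2l.
Qed.

Lemma fbound_ip f : f \in rk_pred -> fbound f (sqrtC (ip f f)).
Proof.
move=> fP y; have yP := kcomb_rk_pred y.
rewrite -(@ler_pXn2r _ 2%N)// ?nnegrE ?mulr_ge0 ?knorm_ge0 ?sqrtC_ge0 ?ip_self_ge0//.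
rewrite exprMn knorm_sqr sqrtCK; apply: scalar_cauchy_schwarz; first exact: kform_ge0.
move=> t; have tfy : (- t) *: kcomb y + f \in rk_pred by exact: rk_pred_linear.
have := ip_self_ge0 tfy; rewrite ip_linear//.
rewrite (ip_conjC tfy)// (ip_conjC tfy fP) !ip_linear//.
rewrite !rmorphD !rmorphM !rmorphN/= -!ip_conjC// !ip_kcomb// -/(kform y y).
rewrite (ip_conjC fP yP) ip_kcomb//.
set u := (X in 0 <= X -> _); set v := (X in _ -> 0 <= X).
by have -> : u = v by rewrite /u /v; ring.
Qed.

(** With [fbound_ip], this identifies the norm of [f] as its least [fbound], so norm convergence can
    be checked against finite combinations. *)
Lemma ip_self_le f M : f \in rk_pred -> 0 <= M -> fbound f M -> sqrtC (ip f f) <= M.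
Proof.
move=> fP M0 fM; rewrite -[leRHS]sqrCK//; apply: sqrtC_le; first exact: ip_self_ge0.
have [k fk] := ipP fP fP.
apply: (@le_eps _ _ _ (k + M)).
- by rewrite ger0_real// ip_self_ge0.
- by rewrite ger0_real// exprn_ge0.
move=> e e0; have [y fy] := (rk_predP _ fP) e e0.
rewrite -(ger0_norm (ip_self_ge0 fP)) -(subrK (pairing f y) (ip f f)).
apply: le_trans (ler_normD _ _) _; rewrite addrC mulrDl addrCA addrC lerD ?fk//.
apply: le_trans (fM y) _; rewrite expr2 -mulrDr ler_wpM2l//.
apply: knorm_le; first by rewrite addr_ge0// ltW.
have -> : kcomb y = f - (f - kcomb y) by rewrite opprB addrC subrK.
exact: fboundB.
Qed.

(** Pairing [f] with the single kernel function at [w] in the direction [f w] produces [|f w|^2],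
    and [knorm] of that function is controlled by the bound of [K w w]. *)
Lemma fbound_eval w : exists2 k : C, 0 <= k &
  forall f s, 0 <= s -> fbound f s -> `|f w| <= k * s.
Proof.
have [M M0 KM] := bop_bound_ge0 (K w w).
exists (sqrtC M); first by rewrite sqrtC_ge0.
move=> f s s0 fs; have [->|xn0] := eqVneq `|f w| 0.
  by rewrite mulr_ge0// sqrtC_ge0.
have x0 : 0 < `|f w| by rewrite lt_def xn0/=.
have := fs [:: (w, f w)]; rewrite /pairing big_seq1/= inner_norm normrX normr_id.
have kE : kform [:: (w, f w)] [:: (w, f w)] = <|K w w (f w), f w|>.
  by rewrite /kform /pairing big_seq1 /kcomb big_seq1.
have kle : knorm [:: (w, f w)] <= sqrtC M * `|f w|.
  rewrite -(@ler_pXn2r _ 2%N)// ?nnegrE ?mulr_ge0 ?knorm_ge0 ?sqrtC_ge0//.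
  rewrite knorm_sqr exprMn sqrtCK expr2 mulrA kE.
  have <- : `|<|K w w (f w), f w|>| = <|K w w (f w), f w|>.
    by rewrite -kE ger0_norm// kform_ge0.
  by apply: le_trans (cauchy_schwarz _ _) _; rewrite ler_wpM2r.
move=> /le_trans/(_ (ler_wpM2l s0 kle)).
by rewrite mulrA expr2 ler_pM2r// mulrC.
Qed.

End MooreAronszajn.

(* The module structure depends on the positivity of [K]; canonical instances
   can only be found if the predicate and the type mention that proof. *)
Definition rkfun_pred (R : realType) (W : Type) (E : hilbertType R)
  (K : W -> W -> bop E E) & positive_kernel K : pred (W -> E) := rk_pred K.

Record rkfun (R : realType) (W : Type) (E : hilbertType R)
    (K : W -> W -> bop E E) (Kpos : positive_kernel K) := RKfun {
  rkfun_val :> W -> E;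
  rkfun_prop : rkfun_val \in rkfun_pred Kpos
}.

Section MooreAronszajnSpace.
Context (R : realType) (W : Type) (E : hilbertType R) (K : W -> W -> bop E E).
Variable Kpos : positive_kernel K.
Local Notation H := (rkfun Kpos).

HB.instance Definition _ :=
  GRing.isSubmodClosed.Build R[i] (W -> E) (rkfun_pred Kpos) (rk_pred_submod Kpos).
HB.instance Definition _ := [isSub for @rkfun_val R W E K Kpos].
HB.instance Definition _ := [Choice of H by <:].
HB.instance Definition _ := [SubChoice_isSubLmodule of H by <:].

Let valB (f g : H) : rkfun_val (f - g) = rkfun_val f - rkfun_val g.
Proof. by []. Qed.

Definition rkip (f g : H) : R[i] := ip K (rkfun_val f) (rkfun_val g).

Fact rkipDl f g h : rkip (f + g) h = rkip f h + rkip g h.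
Proof.
have := ip_linear Kpos 1 (rkfun_prop f) (rkfun_prop g) (rkfun_prop h).
by rewrite scale1r mul1r.
Qed.

Fact rkip0 h : rkip 0 h = 0.
Proof. by apply: (@addrI _ (rkip 0 h)); rewrite -rkipDl !addr0. Qed.

Fact rkipZl a f h : rkip (a *: f) h = a * rkip f h.
Proof.
have := ip_linear Kpos a (rkfun_prop f) (rkfun_prop (0 : H)) (rkfun_prop h).
by rewrite addr0 -/(rkip 0 h) rkip0 addr0.
Qed.

Fact rkip_conj f g : rkip g f = (rkip f g)^*.
Proof. exact: (ip_conjC Kpos (rkfun_prop f) (rkfun_prop g)). Qed.

Fact rkip_ge0 f : 0 <= rkip f f.
Proof. exact: (ip_self_ge0 Kpos (rkfun_prop f)). Qed.

Fact rkip_fbound f : fbound K (rkfun_val f) (sqrtC (rkip f f)).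
Proof. exact: (fbound_ip Kpos (rkfun_prop f)). Qed.

Fact rkip_eq0 f : rkip f f = 0 -> f = 0.
Proof.
move=> f0; apply: val_inj; apply/funext => w.
have [k k0 kP] := fbound_eval Kpos w.
have := kP _ _ (lexx 0); move=> /(_ (rkfun_val f)) h.
apply/eqP; rewrite -normr_le0 -(mulr0 k); apply: h.
by have := @rkip_fbound f; rewrite f0 sqrtC0.
Qed.

Fact rkip_complete (F : set_system H) : ProperFilter F ->
  (forall e : R[i], 0 < e -> exists f, F [set g | sqrtC (rkip (f - g) (f - g)) < e]) ->
  exists f, forall e : R[i], 0 < e -> F [set g | sqrtC (rkip (f - g) (f - g)) < e].
Proof.
move=> FF Fc.
have normB (f g : H) : fbound K (rkfun_val f - rkfun_val g) (sqrtC (rkip (f - g) (f - g))).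
  by rewrite -valB; exact: rkip_fbound.
have s0 (f : H) : 0 <= sqrtC (rkip f f) by rewrite sqrtC_ge0 rkip_ge0.
have flim w : exists c, forall e : R[i], 0 < e ->
    F [set g : H | `|c - rkfun_val g w| < e].
  apply: (@hilbert_complete R E ((fun g : H => rkfun_val g w) @ F) _).
  move=> e e0; have [k k0 kP] := fbound_eval Kpos w.
  have k1 : 0 < k + 1 by rewrite ltr_wpDl.
  have [f Ff] := Fc _ (divr_gt0 e0 k1); exists (rkfun_val f w).
  apply: (@filterS _ F FF _ _ _ Ff) => g /= fg.
  apply: le_lt_trans (kP _ _ (s0 _) (normB f g)) _.
  apply: (@le_lt_trans _ _ ((k + 1) * sqrtC (rkip (f - g) (f - g)))).
    by rewrite ler_wpM2r// lerDl.
  by rewrite mulrC -ltr_pdivlMr.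
have {flim}[f flim] := choice flim.
have fpair y (e : R[i]) : 0 < e ->
    F [set g : H | `|pairing (f - rkfun_val g) y| <= (\sum_(q <- y) `|q.2|) * e].
  move=> e0; elim: y => [|q y IHy].
    by apply: filterS filterT => g _ /=; rewrite /pairing !big_nil normr0 mul0r.
  apply: (@filterS _ F FF _ _ _ (filterI (flim q.1 e e0) IHy)) => g [/= fq IH].
  rewrite /pairing !big_cons mulrDl; apply: le_trans (ler_normD _ _) _.
  rewrite lerD//; apply: le_trans (cauchy_schwarz _ _) _.
  by rewrite mulrC ler_wpM2l// ltW.
have Ff e : 0 < e -> F [set g : H | fbound K (f - rkfun_val g) e].
  move=> e0; have [g0 Fg0] := Fc (e / 2) (divr_gt0 e0 (ltr0Sn _ 1)).
  apply: (@filterS _ F FF _ _ _ Fg0) => g /= g0g y.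
  apply: (@le_eps _ _ _ (\sum_(q <- y) `|q.2|)).
  - by rewrite ger0_real.
  - by rewrite ger0_real// mulr_ge0 ?knorm_ge0// ltW.
  move=> d d0.
  (* [h] may depend on [y] and [d]: it stays within [e] of [g] in norm, and its error against [f] on
     [y] disappears with [d]. *)
  have [h [/= g0h fh]] := filter_ex (filterI Fg0 (fpair y d d0)).
  have -> : f - rkfun_val g = (f - rkfun_val h) + (rkfun_val h - rkfun_val g).
    by rewrite addrA subrK.
  rewrite pairingD addrC; apply: le_trans (ler_normD _ _) _.
  rewrite addrC [leRHS]addrC lerD//.
  have := fbound_sub (fbound_subC (normB g0 h)) (normB g0 g).
  move=> /(_ y) hg; apply: le_trans hg _.
  rewrite ler_wpM2r ?knorm_ge0// [leRHS](splitr e).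
  by rewrite lerD// ltW.
have fP : f \in rk_pred K.
  apply/rk_predP => e e0.
  have e20 : 0 < e / 2 by rewrite divr_gt0.
  have [g fg] := filter_ex (Ff _ e20).
  have [x gx] := (rk_predP _ _ (rkfun_prop g)) _ e20.
  by exists x; rewrite [e]splitr; exact: (fbound_sub fg gx).
exists (@RKfun R W E K Kpos f fP : H) => e e0.
have e20 : 0 < e / 2 by rewrite divr_gt0.
apply: (@filterS _ F FF _ _ _ (Ff _ e20)) => g fg /=.
apply: (@le_lt_trans _ _ (e / 2)); last by rewrite ltr_pdivrMr// ltr_pMr// ltr1n.
apply: (ip_self_le Kpos (rkfun_prop _) (ltW e20)).
by rewrite valB.
Qed.

HB.instance Definition _ := Lmodule_isHilbert.Build R H
  rkipDl rkipZl rkip_conj rkip_ge0 rkip_eq0 rkip_complete.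

Lemma moore_aronszajn : inhabited (rkhs K).
Proof.
pose ker w c : H := @RKfun R W E K Kpos _ (kcomb_rk_pred Kpos [:: (w, c)]).
apply: inhabits; apply: (@RKHS R W E K H (fun f : H => rkfun_val f) _ _ ker).
- by move=> z a f g.
- by move=> f g fg; apply: val_inj.
- by move=> w c z; rewrite /= /kcomb big_seq1.
- move=> f w c; rewrite -[LHS]/(rkip f (ker w c)).
  by rewrite /rkip ip_kcomb ?rkfun_prop// /pairing big_seq1.
Qed.

End MooreAronszajnSpace.

(** * Colligations *)

Section PairOperators.
Context {R : realType} {X Y : hilbertType R}.

Fact hfst_bounded : (fun x : hsum X Y => x.1) \in @bounded_op R (hsum X Y) X.
Proof.
apply/bounded_opP; split=> //; exists 1 => x; rewrite mul1r.
exact: hsum_fst_le.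
Qed.

Fact hsnd_bounded : (fun x : hsum X Y => x.2) \in @bounded_op R (hsum X Y) Y.
Proof.
apply/bounded_opP; split=> //; exists 1 => x; rewrite mul1r.
exact: hsum_snd_le.
Qed.

Fact hinl_bounded : (fun x : X => (x, 0) : hsum X Y) \in @bounded_op R X (hsum X Y).
Proof.
apply/bounded_opP; split=> [a x y|].
  by apply: injective_projections => //=; rewrite scaler0 addr0.
exists 1 => x; rewrite mul1r; apply: le_trans (hsum_norm_le_sum _) _.
by rewrite normr0 addr0.
Qed.

Fact hinr_bounded : (fun y : Y => (0, y) : hsum X Y) \in @bounded_op R Y (hsum X Y).
Proof.
apply/bounded_opP; split=> [a x y|].
  by apply: injective_projections => //=; rewrite scaler0 addr0.
exists 1 => x; rewrite mul1r; apply: le_trans (hsum_norm_le_sum _) _.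
by rewrite normr0 add0r.
Qed.

Definition hfst : bop (hsum X Y) X := Bop hfst_bounded.
Definition hsnd : bop (hsum X Y) Y := Bop hsnd_bounded.
Definition hinl : bop X (hsum X Y) := Bop hinl_bounded.
Definition hinr : bop Y (hsum X Y) := Bop hinr_bounded.

Lemma hsumE (x : X) (y : Y) : (x, y) = hinl x + hinr y.
Proof. by apply: injective_projections => /=; rewrite ?addr0 ?add0r. Qed.

Lemma hsum_norm2 (x : hsum X Y) : `|x| ^+ 2 = `|x.1| ^+ 2 + `|x.2| ^+ 2.
Proof. by rewrite -!inner_norm hsum_innerE. Qed.

End PairOperators.

Lemma hsum_norm_le (R : realType) (X Y X' Y' : hilbertType R)
    (x : hsum X Y) (x' : hsum X' Y') :
  `|x.1| <= `|x'.1| -> `|x.2| <= `|x'.2| -> `|x| <= `|x'|.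
Proof.
move=> h1 h2; rewrite -(@ler_pXn2r _ 2%N)// ?nnegrE// !hsum_norm2 lerD//.
  by rewrite ler_pXn2r// ?nnegrE.
by rewrite ler_pXn2r// ?nnegrE.
Qed.

Lemma closed_subspace_preimage (R : realType) (X Y : hilbertType R)
  (T : bop X Y) (D : set Y) : closed_subspace D -> closed_subspace (T @^-1` D).
Proof.
move=> sD; split=> [|a x y Dx Dy|x xD] /=.
- by rewrite /preimage/= bop0r; case: sD.
- by rewrite /preimage/= bop_linear; exact: subspaceP.
apply: subspace_closed => // e e0; have [M M0 TM] := bop_bound_ge0 T.
have M1 : 0 < M + 1 by rewrite ltr_wpDl.
have [a Da xa] := xD _ (divr_gt0 e0 M1); exists (T a) => //.
rewrite -bopBr; apply: le_lt_trans (TM _) _.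
apply: (@le_lt_trans _ _ ((M + 1) * `|x - a|)); first by rewrite ler_wpM2r// lerDl.
by rewrite mulrC -ltr_pdivlMr.
Qed.

Section Slots.
Context {R : realType} {d : nat} {X : hilbertType R}.

Lemma slotE (i j : 'I_d) (x : X) : slot X i x j = if j == i then x else 0.
Proof. by rewrite /= ffunE. Qed.

Lemma inner_slotl i (x : X) (y : hpow d X) : <|slot X i x, y|> = <|x, y i|>.
Proof.
rewrite hpow_innerE (bigD1 i)//= ffunE eqxx big1 ?addr0// => j ji.
by rewrite ffunE (negPf ji) inner0l.
Qed.

Lemma inner_slotr i (x : X) (y : hpow d X) : <|y, slot X i x|> = <|y i, x|>.
Proof. by rewrite inner_conj inner_slotl -inner_conj. Qed.

Lemma adj_slotE i (y : hpow d X) : adj (slot X i) y = y i.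
Proof. by apply: inner_inj => x; rewrite adjEl inner_slotr. Qed.

Lemma hpow_slot_sum (y : hpow d X) : y = \sum_i slot X i (y i).
Proof.
by apply: inner_inj => z; rewrite inner_suml hpow_innerE;
  apply: eq_bigr => i _; rewrite inner_slotl.
Qed.

Lemma Zop0 (x : hpow d X) : Zop X (uball0 R d) x = 0.
Proof. by rewrite /= big1// => i _; rewrite mxE scale0r. Qed.

(* The adjoint of [Zop X z] maps [y] to the column with entries [conj z_j y],
   whose norm is [|z| |y|]. *)
Lemma Zop_norm (z : 'rV[R[i]]_d) (x : hpow d X) :
  `|Zop X z x| <= sqrtC (\sum_i `|z 0 i| ^+ 2) * `|x|.
Proof.
set s := sqrtC _; have s0 : 0 <= s.
  by rewrite sqrtC_ge0 sumr_ge0// => i _; rewrite exprn_ge0.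
set y := Zop X z x; pose v : hpow d X := [ffun j => (z 0 j)^* *: y].
have s2 : s ^+ 2 = \sum_i `|z 0 i| ^+ 2 by exact: sqrtCK.
have vn : `|v| = s * `|y|.
  apply: sqr_norm_inj; first by rewrite mulr_ge0.
  rewrite exprMn s2 -inner_norm hpow_innerE mulr_suml.
  by apply: eq_bigr => i _; rewrite ffunE inner_norm normrZ exprMn norm_conjC.
have yv : `|y| ^+ 2 = <|x, v|>.
  rewrite -inner_norm {1}/y /= inner_suml hpow_innerE; apply: eq_bigr => i _.
  by rewrite ffunE innerZl innerZr conjCK.
have [->|yn0] := eqVneq `|y| 0; first by rewrite mulr_ge0.
have y0 : 0 < `|y| by rewrite lt_def yn0/=.
rewrite -(ler_pM2r y0) -expr2 -(ger0_norm (exprn_ge0 2 (ltW y0))) yv.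
by apply: le_trans (cauchy_schwarz _ _) _; rewrite vn mulrA (mulrC `|x|).
Qed.

Lemma uball_norm (z : uball R d) :
  0 <= sqrtC (\sum_i `|(z : 'rV[R[i]]_d) 0 i| ^+ 2) < 1.
Proof.
have s0 : 0 <= \sum_i `|(z : 'rV[R[i]]_d) 0 i| ^+ 2.
  by rewrite sumr_ge0// => i _; rewrite exprn_ge0.
rewrite sqrtC_ge0 s0/= -(@ltr_pXn2r _ 2%N)// ?nnegrE ?sqrtC_ge0//.
by rewrite sqrtCK expr1n; case: z s0.
Qed.

End Slots.

Lemma bop_sumE (R : realType) (X Y : hilbertType R) I (r : seq I) (P : pred I)
    (F : I -> bop X Y) x :
  (\sum_(i <- r | P i) F i) x = \sum_(i <- r | P i) F i x.
Proof. exact: (big_morph (fun T : bop X Y => T x) (fun _ _ => erefl) erefl). Qed.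

Section Colligations.
Context {R : realType} {d : nat} {X U Y : hilbertType R}.
Variable M : colligation d X U Y.
Local Notation A := (colA M).
Local Notation B := (colB M).
Local Notation C := (colC M).
Local Notation D := (colD M).
Implicit Type w : uball R d.

Lemma colopE (x : X) (u : U) : colop M (x, u) = (A x + B u, C x + D u).
Proof. by []. Qed.

Definition state (w : uball R d) : bop U (hpow d X) :=
  bop_inv (bop_id _ - A \oB Zop X w) \oB B.

Hypothesis Mcontr : contractive (colop M).

Lemma colA_contractive x : `|A x| <= `|x|.
Proof.
have := Mcontr (x, 0); rewrite colopE !bop0r !addr0.
move=> /(le_trans (hsum_fst_le _)) /= /le_trans; apply.
by apply: le_trans (hsum_norm_le_sum _) _; rewrite normr0 addr0.
Qed.

Lemma resolventAZ w : is_inverse (bop_id _ - A \oB Zop X w)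
  (bop_inv (bop_id _ - A \oB Zop X w)).
Proof.
have /andP[s0 s1] := uball_norm w; apply: (invertible_id_sub s0 s1) => x.
exact: le_trans (colA_contractive _) (Zop_norm _ _).
Qed.

Lemma resolventZA w : is_inverse (bop_id _ - Zop X w \oB A)
  (bop_inv (bop_id _ - Zop X w \oB A)).
Proof.
have /andP[s0 s1] := uball_norm w; apply: (invertible_id_sub s0 s1) => x.
by apply: le_trans (Zop_norm _ _) _; rewrite ler_wpM2l// colA_contractive.
Qed.

Lemma stateP w u : state w u = A (Zop X w (state w u)) + B u.
Proof.
have [_ h] := resolventAZ w.
have E : state w u - A (Zop X w (state w u)) = B u.
  exact: (congr1 (fun T : bop _ _ => T (B u)) h).
by rewrite -E addrC subrK.
Qed.

(** States are identified by checking a fixed-point equation, without computing an inverse. *)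
Lemma state_uniq w u x : x = A (Zop X w x) + B u -> state w u = x.
Proof.
have [h _] := resolventAZ w; move=> xE.
have BE : B u = x - A (Zop X w x) by rewrite {1}xE addrAC subrr add0r.
rewrite /state -[LHS]/(bop_inv _ (B u)) BE.
exact: (congr1 (fun T : bop _ _ => T x) h).
Qed.

(** The push-through identity [(I - Z A)^-1 Z = Z (I - A Z)^-1], applied to [B u]. *)
Lemma charfunE w u : charfun M w u = C (Zop X w (state w u)) + D u.
Proof.
rewrite /charfun bopDE addrC; congr (_ + _).
have [h _] := resolventZA w; pose x := Zop X w (state w u).
have ZBE : Zop X w (B u) = x - Zop X w (A x).
  by rewrite /x -bopBr {1}(stateP w u) addrAC subrr add0r.
rewrite -[LHS]/(C (bop_inv (bop_id _ - Zop X w \oB A) (Zop X w (B u)))) ZBE.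
congr (C _); exact: (congr1 (fun T : bop _ _ => T x) h).
Qed.

(** The inputs here are the ones on which weak isometry is tested, so the action of the colligation
    on them carries the whole theory. *)
Lemma colop_state w u :
  colop M (Zop X w (state w u), u) = (state w u, charfun M w u).
Proof. by rewrite colopE -stateP -charfunE. Qed.

End Colligations.

Lemma colop_surj (R : realType) (d : nat) (X U Y : hilbertType R)
    (T : bop (hsum X U) (hsum (hpow d X) Y)) :
  exists M : colligation d X U Y, colop M = T.
Proof.
exists (Colligation (hfst \oB T \oB hinl) (hfst \oB T \oB hinr)
  (hsnd \oB T \oB hinl) (hsnd \oB T \oB hinr)).
apply: bopP => -[x u]; rewrite colopE hsumE bopDr.
by apply: injective_projections.
Qed.

(** * The functional model on the reproducing kernel space *)

Section FunctionalModel.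
Context {R : realType} {d : nat} {U Y : hilbertType R}.
Variables (S : uball R d -> bop U Y)
  (Phi : uball R d -> uball R d -> bop (hpow d U) (hpow d U)) (H : rkhs Phi).

Lemma inner_rk_ker w z c e : <|rk_ker H w c, rk_ker H z e|> = <|Phi z w c, e|>.
Proof. by rewrite rk_repr rk_kerE. Qed.

Lemma inner_phi_col i j w z u v :
  <|phi_col H j w u, phi_col H i z v|> = <|block i j (Phi z w) u, v|>.
Proof. by rewrite inner_rk_ker /block /= adjEl. Qed.

(** By the reproducing property, a vector orthogonal to all columns at [w] has value zero at [w];
    evaluation is injective. *)
Lemma phi_col_total :
  closed_span [set h | exists w u j, h = phi_col H j w u] = setT.
Proof.
apply: closed_subspace_total => [|y yphi]; first exact: closed_span_subspace.
have y0 w : rk_eval y w = 0.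
  apply: inner_inj => c; rewrite inner0l (hpow_slot_sum c) inner_sumr big1// => j _.
  rewrite -rk_repr; apply: yphi; apply: sub_closed_span.
  by exists w, (c j), j.
apply: rk_eval_inj; apply/funext => w; rewrite y0.
have := rk_evalP w 1 0 (0 : H); rewrite scale1r addr0 scale1r.
by move=> /(congr1 (fun x => x - rk_eval (0 : H) w)); rewrite addrK subrr.
Qed.

Lemma phi_ZE w u : phi_Z H w u = Zop H w (phi_T H w u).
Proof. by rewrite /phi_Z /=; apply: eq_bigr => j _; rewrite ffunE. Qed.

Lemma phi_Z0 u : phi_Z H (uball0 R d) u = 0.
Proof. by rewrite phi_ZE Zop0. Qed.

Lemma Vtilde_dom_subspace : closed_subspace (@Vtilde_dom R d U Phi H).
Proof. exact: (closed_subspace_preimage hfst (closed_span_subspace _)). Qed.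

Lemma Vtilde_dom_gen w u : Vtilde_dom (phi_Z H w u, u).
Proof. by apply: sub_closed_span; exists w, u. Qed.

(** The generator at the origin is [(0, u)]; subtracting it from [(phi_Z w u, u)] separates the two
    summands of the domain. *)
Lemma Vtilde_dom_min (D : set (hsum H U)) : closed_subspace D ->
  (forall w u, D (phi_Z H w u, u)) -> @Vtilde_dom R d U Phi H `<=` D.
Proof.
move=> sD Dgen [h u] Dh; rewrite hsumE.
have Du v : D (hinr v) by have := Dgen (uball0 R d) v; rewrite phi_Z0.
apply: subspaceD => //; move: h Dh; rewrite /Vtilde_dom /=.
apply: closed_span_min; first exact: (closed_subspace_preimage hinl sD).
move=> _ [w [v ->]]; rewrite /preimage /=.
have := subspaceB sD (Dgen w v) (Du v).
by rewrite hsumE addrK.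
Qed.

(** The decomposition applied to [u] and paired with [v], with the negative terms moved across so
    that each side is an inner product. *)
Lemma gram_model : kernel_decomposition S Phi -> forall w z u v,
  <|phi_Z H w u, phi_Z H z v|> + <|u, v|> =
  <|phi_T H w u, phi_T H z v|> + <|S w u, S z v|>.
Proof.
move=> dec w z u v.
have E : <|(bop_id U - adj (S z) \oB S w) u, v|> = <|u, v|> - <|S w u, S z v|>.
  by rewrite bopDE bopNE innerBl adjEl.
move: E; rewrite dec bopDE bopNE innerBl !bop_sumE.
rewrite [X in X - _ = _ -> _]inner_suml [X in _ - X = _ -> _]inner_suml.
have -> : \sum_j <|block j j (Phi z w) u, v|> = <|phi_T H w u, phi_T H z v|>.
  by rewrite hpow_innerE; apply: eq_bigr => j _; rewrite !ffunE inner_phi_col.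
have -> : \sum_i <|(\sum_l ((z : 'rV_d) 0 i)^* * (w : 'rV_d) 0 l
                            *: block i l (Phi z w)) u, v|> =
    <|phi_Z H w u, phi_Z H z v|>.
  rewrite /phi_Z inner_sumr; apply: eq_bigr => i _.
  rewrite innerZr !inner_suml bop_sumE inner_suml mulr_sumr.
  by apply: eq_bigr => l _; rewrite bopZE !innerZl inner_phi_col mulrA.
by move=> /eqP; rewrite subr_eq => /eqP->; ring.
Qed.

Lemma dcfm_colligationP (M : colligation d H U Y) : dcfm_colligation S M <->
  contractive (colop M) /\
  forall w u, colop M (phi_Z H w u, u) = (phi_T H w u, S w u).
Proof.
split=> -[Mc Mgen]; split=> // w u.
  have [AE CE BE DE] := Mgen w u.
  by rewrite colopE AE CE BE DE !subrK.
have := Mgen (uball0 R d) u; have := Mgen w u.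
rewrite !colopE phi_Z0 !bop0r !add0r => -[<- <-] [-> ->].
by split; rewrite ?addrK.
Qed.

(** [V] is controlled only on its domain, so the equalizer with [T] is intersected with the domain.
    Its closedness costs one [|x - a|] for the contraction and one for the isometry. *)
Lemma is_Vtilde_eq V (T : bop (hsum H U) (hsum (hpow d H) Y)) :
  is_Vtilde S H V -> contractive T ->
  (forall w u, T (phi_Z H w u, u) = (phi_T H w u, S w u)) ->
  forall x, Vtilde_dom x -> T x = V x.
Proof.
move=> [Vlin Viso Vgen] Tc Tgen.
have sD := Vtilde_dom_subspace.
suff: @Vtilde_dom R d U Phi H `<=` [set x | Vtilde_dom x /\ T x = V x].
  by move=> DV x /DV[].
apply: Vtilde_dom_min => [|w u]; last by split; [exact: Vtilde_dom_gen|rewrite Tgen Vgen].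
have VB x y : Vtilde_dom x -> Vtilde_dom y -> V (x - y) = V x - V y.
  by move=> Dx Dy; rewrite addrC -scaleN1r Vlin// scaleN1r addrC.
have D0 : @Vtilde_dom R d U Phi H 0 by case: sD.
split=> [|a x y [Dx xE] [Dy yE]|x xD].
- split=> //; rewrite bop0r; have := VB _ _ D0 D0.
  by rewrite !subrr.
- by split; [exact: (subspaceP sD)|rewrite bop_linear Vlin// xE yE].
have Dx : Vtilde_dom x.
  by apply: (subspace_closed sD) => e /xD[a [Da _] xa]; exists a.
split=> //; apply/eqP; rewrite -subr_eq0 -normr_eq0; apply/eqP.
apply: (@le_eps_eq0 _ 2) => // e /xD[a [Da aE] xa].
have -> : T x - V x = T (x - a) - V (x - a) by rewrite bopBr VB// aE opprB addrA subrK.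
apply: le_trans (ler_normB _ _) _.
rewrite (Viso (x - a)); last exact: (subspaceB sD).
rewrite mulr_natl mulr2n; apply: lerD; last exact: ltW.
exact: le_trans (Tc _) (ltW xa).
Qed.

Hypothesis dec : kernel_decomposition S Phi.

(** One operator supplies both existence claims: restricted to the domain it is [Vtilde], and its
    blocks form a d.c.f.m. colligation. *)
Lemma model_contraction : exists T : bop (hsum H U) (hsum (hpow d H) Y),
  [/\ contractive T, isometric_on (@Vtilde_dom R d U Phi H) T &
      forall w u, T (phi_Z H w u, u) = (phi_T H w u, S w u)].
Proof.
pose g (p : uball R d * U) : hsum H U := (phi_Z H p.1 p.2, p.2).
pose h (p : uball R d * U) : hsum (hpow d H) Y := (phi_T H p.1 p.2, S p.1 p.2).
have [[w u] [z v]|T [Tg Tc Tiso]] := @gram_contraction _ _ _ _ g h.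
  by rewrite !hsum_innerE /=; exact: gram_model.
exists T; split=> // [x Dx|w u]; last exact: (Tg (w, u)).
apply: Tiso; move: x Dx; apply: Vtilde_dom_min; first exact: closed_span_subspace.
by move=> w u; apply: sub_closed_span; exists (w, u).
Qed.

Lemma is_Vtilde_contraction (T : bop (hsum H U) (hsum (hpow d H) Y)) :
  isometric_on (@Vtilde_dom R d U Phi H) T ->
  (forall w u, T (phi_Z H w u, u) = (phi_T H w u, S w u)) -> is_Vtilde S H T.
Proof. by move=> Tiso Tgen; split=> // a x y _ _; rewrite bop_linear. Qed.

Lemma is_Vtilde_ex : exists V, is_Vtilde S H V.
Proof.
by have [T [_ Tiso Tgen]] := model_contraction; exists T; exact: is_Vtilde_contraction.
Qed.

Lemma dcfm_contractive_extension V (M : colligation d H U Y) :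
  is_Vtilde S H V -> (dcfm_colligation S M <-> contractive_extension V M).
Proof.
move=> VV; rewrite dcfm_colligationP; split=> -[Mc Mgen]; split=> //.
  exact: is_Vtilde_eq.
by move=> w u; rewrite Mgen ?(Vtilde_gen VV)//; exact: Vtilde_dom_gen.
Qed.

Lemma dcfm_ex : exists M : colligation d H U Y, dcfm_colligation S M.
Proof.
have [T [Tc _ Tgen]] := model_contraction; have [M MT] := colop_surj T.
by exists M; rewrite dcfm_colligationP MT.
Qed.

Section Properties.
Variable M : colligation d H U Y.
Hypothesis MS : dcfm_colligation S M.

Let Mc : contractive (colop M). Proof. by case: MS. Qed.

Lemma dcfm_state w u : state M w u = phi_T H w u.
Proof.
apply: state_uniq => //; rewrite -phi_ZE.
by have [_ /(_ w u)[-> _ -> _]] := MS; rewrite subrK.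
Qed.

Lemma dcfm_charfun w : S w = charfun M w.
Proof.
apply: bopP => u; rewrite charfunE// dcfm_state -phi_ZE.
by have [_ /(_ w u)[_ -> _ ->]] := MS; rewrite subrK.
Qed.

(** By [dcfm_state] the generators of [Dtilde_AB M] are the vectors [phi_Z w u], so on this domain
    the colligation coincides with [Vtilde]. *)
Lemma dcfm_weakly_isometric : weakly_isometric M.
Proof.
split=> // x Dx; have [V VV] := is_Vtilde_ex.
have DAB : Dtilde_AB M `<=` @Dtilde R d U Phi H.
  apply: closed_span_min; first exact: closed_span_subspace.
  move=> _ [w [u ->]]; apply: sub_closed_span; exists w, u.
  by rewrite phi_ZE -dcfm_state.
have [_ Mext] := (dcfm_contractive_extension M VV).1 MS.
by rewrite Mext ?(Vtilde_isometric VV)//; exact: DAB.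
Qed.

Lemma dcfm_controllable : controllable M.
Proof.
rewrite /controllable -phi_col_total; congr closed_span.
apply/seteqP; split=> _ [w [u [j ->]]]; exists w, u, j.
  by rewrite -[LHS]/(adj (slot H j) (state M w u)) dcfm_state adj_slotE ffunE.
by rewrite -[RHS]/(adj (slot H j) (state M w u)) dcfm_state adj_slotE ffunE.
Qed.

End Properties.
End FunctionalModel.

(** * The kernel of a weakly isometric colligation *)

Lemma bop_inv_adj (R : realType) (X : hilbertType R) (T : bop X X) :
  is_inverse T (bop_inv T) -> bop_inv (adj T) = adj (bop_inv T).
Proof. by case=> h1 h2; apply: bop_inv_uniq; split; rewrite -adj_comp ?h1 ?h2 adj_id. Qed.

Section ColligationKernel.
Context {R : realType} {d : nat} {X U Y : hilbertType R}.
Variable N : colligation d X U Y.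
Hypothesis Nc : contractive (colop N).
Implicit Types (w z : uball R d).

(** The factor in [col_kernel N z w = G_z^* G_w], with [G_w = state_comb w]; positivity and the Gram
    identity both come from this factorization. *)
Definition state_comb w (c : hpow d U) : X := \sum_l state N w (c l) l.

Lemma state_comb_slot w l u : state_comb w (slot U l u) = state N w u l.
Proof.
rewrite /state_comb (bigD1 l)// slotE eqxx big1 => [|j jl]; first exact: addr0.
by rewrite slotE (negPf jl) bop0r ffunE.
Qed.

Lemma inner_col_kernel w z c e :
  <|col_kernel N z w c, e|> = <|state_comb w c, state_comb z e|>.
Proof.
rewrite /col_kernel /block_op bop_sumE inner_suml /state_comb inner_sumr.
apply: eq_bigr => i _; rewrite bop_sumE !inner_suml; apply: eq_bigr => l _.
have resE : bop_inv (bop_id _ - adj (Zop X z) \oB adj (colA N)) =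
    adj (bop_inv (bop_id _ - colA N \oB Zop X z)).
  by rewrite -(bop_inv_adj (resolventAZ Nc z)) adjB adj_id adj_comp.
rewrite resE; set r := bop_inv (bop_id _ - colA N \oB Zop X z).
set q := bop_inv (bop_id _ - colA N \oB Zop X w).
transitivity <|slot U i (adj (colB N) (adj r (slot X i
    (adj (slot X l) (q (colB N (adj (slot U l) c))))))), e|> => //.
by rewrite inner_slotl !adjEl inner_slotl !adj_slotE.
Qed.

Lemma col_kernel_positive : positive_kernel (col_kernel N).
Proof.
move=> n z c.
have -> : \sum_i \sum_j <|col_kernel N (z i) (z j) (c j), c i|> =
    <|\sum_j state_comb (z j) (c j), \sum_i state_comb (z i) (c i)|>.
  rewrite inner_sumr; apply: eq_bigr => i _; rewrite inner_suml.
  by apply: eq_bigr => j _; exact: inner_col_kernel.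
exact: inner_ge0.
Qed.

(** Weak isometry concerns norms; polarization on the subspace of inputs turns it into an identity
    between states at two different points. *)
Lemma weakly_isometric_inner : weakly_isometric N -> forall w z u v,
  <|Zop X w (state N w u), Zop X z (state N z v)|> + <|u, v|> =
  <|state N w u, state N z v|> + <|charfun N w u, charfun N z v|>.
Proof.
move=> [_ Niso] w z u v.
have sD : closed_subspace [set x : hsum X U | Dtilde_AB N x.1].
  exact: (closed_subspace_preimage hfst (closed_span_subspace _)).
have Dgen (y : uball R d) t : Dtilde_AB N (Zop X y (state N y t)).
  by apply: sub_closed_span; exists y, t.
have := @isometry_inner _ _ _ _ (colop N) _ Niso
  (Zop X w (state N w u), u) (Zop X z (state N z v), v) (Dgen w u) (Dgen z v).
rewrite !colop_state// !hsum_innerE => /(_ _)/esym; apply.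
by move=> a x y Dx Dy; split; [exact: (subspaceP sD)|exact: bop_linear].
Qed.

(** The computation of [gram_model] in reverse, with components of states in place of kernel
    columns. *)
Lemma col_kernel_decomposition : weakly_isometric N ->
  kernel_decomposition (charfun N) (col_kernel N).
Proof.
move=> Niso z w; apply: bopP => u; apply: inner_inj => v.
rewrite !bopDE !bopNE !innerBl adjEl !bop_sumE.
rewrite [X in _ = X - _]inner_suml [X in _ = _ - X]inner_suml.
have blockE i l : <|block i l (col_kernel N z w) u, v|> =
    <|state N w u l, state N z v i|>.
  rewrite -[LHS]/(<|adj (slot U i) (col_kernel N z w (slot U l u)), v|>).
  by rewrite adjEl inner_col_kernel !state_comb_slot.
have -> : \sum_i <|block i i (col_kernel N z w) u, v|> = <|state N w u, state N z v|>.
  by rewrite hpow_innerE; apply: eq_bigr => i _; rewrite blockE.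
set s := (X in _ = _ - X).
have -> : s = <|Zop X w (state N w u), Zop X z (state N z v)|>.
  rewrite [RHS]inner_sumr; apply: eq_bigr => i _.
  rewrite bop_sumE inner_suml innerZr [RHS]mulrC [X in _ = X * _]inner_suml mulr_suml.
  by apply: eq_bigr => l _; rewrite bopZE !innerZl blockE; ring.
have := weakly_isometric_inner Niso w z u v.
by move=> /(canRL (addrK _))->; ring.
Qed.

End ColligationKernel.

Lemma isometry_adjK (R : realType) (X Y : hilbertType R) (T : bop X Y) :
  (forall x, `|T x| = `|x|) -> adj T \oB T = bop_id X.
Proof.
move=> Tiso; apply: bopP => x; apply: inner_inj => y.
rewrite -[LHS]/(<|adj T (T x), y|>) adjEl.
apply: (@isometry_inner _ _ _ setT) => // a u v _ _.
by split=> //; exact: bop_linear.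
Qed.

Lemma dsumE (R : realType) (d : nat) (X Y : hilbertType R) (T : bop X Y)
  (x : hpow d X) j : dsum d T x j = T (x j).
Proof. by rewrite /= ffunE. Qed.

Lemma dsum_norm (R : realType) (d : nat) (X Y : hilbertType R) (T : bop X Y)
  (x : hpow d X) : (forall x, `|T x| = `|x|) -> `|dsum d T x| = `|x|.
Proof.
move=> Tiso; apply: sqr_norm_inj => //; rewrite -!inner_norm !hpow_innerE.
by apply: eq_bigr => i _; rewrite dsumE !inner_norm Tiso.
Qed.

Lemma Zop_dsum (R : realType) (d : nat) (X Y : hilbertType R) (T : bop X Y)
  (z : 'rV[R[i]]_d) (x : hpow d X) : Zop Y z (dsum d T x) = T (Zop X z x).
Proof.
rewrite [Zop X z x]/= bop_sumr /=; apply: eq_bigr => j _.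
by rewrite ffunE bopZr.
Qed.

(** * Unitary equivalence with the functional model *)

Section Realization.
Context {R : realType} {d : nat} {X U Y : hilbertType R}.
Variable N : colligation d X U Y.
Hypothesis Nctrl : controllable N.
Hypothesis Nc : contractive (colop N).
Variable H : rkhs (col_kernel N).

(* The unitary sends the [j]-th component of [(I - A Z(w))^-1 B u] to
   [Phi_{.j}(., w) u]; the two families have the same Gram matrix. *)
Lemma model_unitary : exists T : bop X H, unitary T /\
  forall w j u, T (state N w u j) = phi_col H j w u.
Proof.
pose g (p : uball R d * hpow d U) := state_comb N p.1 p.2.
pose h (p : uball R d * hpow d U) := rk_ker H p.1 p.2.
have [[w c] [z e]|T [Tg Tc Tiso]] := @gram_contraction _ _ _ _ g h.
  by rewrite /h inner_rk_ker inner_col_kernel.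
have Tstate w j u : T (state N w u j) = phi_col H j w u.
  by rewrite -state_comb_slot (Tg (w, _)).
(* Controllability says that the components of the states are total, so the isometry on the closed
   span is one on all of [X]. *)
have gT : closed_span (range g) = setT.
  apply/seteqP; split=> // x _; have : [set: X] x by [].
  rewrite -Nctrl; apply: closed_span_min; first exact: closed_span_subspace.
  move=> _ [w [u [j ->]]]; apply: sub_closed_span; exists (w, slot U j u) => //.
  by rewrite /g /= state_comb_slot -[RHS]/(adj (slot X j) (state N w u)) adj_slotE.
have Tn x : `|T x| = `|x| by apply: Tiso; rewrite gT.
have TT := isometry_adjK Tn; exists T; split=> //; split=> //.
(* Surjectivity: each kernel column is in the range of [T], where [T (adj T y) = y], and the columns
   are total. *)
apply: (bop_eq_on_span (phi_col_total H)) => _ [w [u [j ->]]].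
rewrite -Tstate -[LHS]/(T (adj T (T (state N w u j)))).
by rewrite -[adj T (T _)]/((adj T \oB T) _) TT.
Qed.

(** [N] is conjugated by the unitary. Since [dsum d T] carries states to [phi_T] and commutes with
    [Zop], the action of [N] on its states becomes the defining property of the model. *)
Lemma model_realization : exists M : colligation d H U Y,
  dcfm_colligation (charfun N) M /\ unitarily_equivalent N M.
Proof.
have [T [[TT TT'] Tstate]] := model_unitary.
have TK x : adj T (T x) = x := congr1 (fun V : bop X X => V x) TT.
have TK' y : T (adj T y) = y := congr1 (fun V : bop H H => V y) TT'.
have Tn x : `|T x| = `|x|.
  by rewrite -[LHS]sqrtC_inner -adjE TK sqrtC_inner.
have Tstates w u : dsum d T (state N w u) = phi_T H w u.
  by apply/ffunP => j; rewrite dsumE Tstate ffunE.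
pose M := Colligation (dsum d T \oB colA N \oB adj T) (dsum d T \oB colB N)
  (colC N \oB adj T) (colD N).
have colME h u : colop M (h, u) =
    (dsum d T (colop N (adj T h, u)).1, (colop N (adj T h, u)).2).
  by apply: injective_projections => //; rewrite [RHS]bopDr.
exists M; split; last first.
  split=> //; exists T; split=> //; split=> //; apply: bopP => x.
  - by rewrite -[RHS]/(dsum d T (colA N (adj T (T x)))) TK.
  - by rewrite -[RHS]/(colC N (adj T (T x))) TK.
apply/dcfm_colligationP; split=> [[h u]|w u].
  rewrite colME; apply: (@le_trans _ _ `|colop N (adj T h, u)|).
    by apply: hsum_norm_le => //=; rewrite dsum_norm.
  apply: le_trans (Nc _) _; apply: hsum_norm_le => //=.
  by rewrite -Tn TK'.
by rewrite colME phi_ZE -Tstates Zop_dsum TK colop_state.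
Qed.

End Realization.

Theorem theorem3p3 (R : realType) (d : nat) (d_gt0 : (0 < d)%N)
    (U Y : hilbertType R) (S : uball R d -> bop U Y) (S_schur : schur_class S) :
  (forall Phi : uball R d -> uball R d -> bop (hpow d U) (hpow d U),
     positive_kernel Phi -> kernel_decomposition S Phi ->
     inhabited (rkhs Phi) /\
     forall H : rkhs Phi,
       [/\ (exists V, is_Vtilde S H V),
           (forall V, is_Vtilde S H V ->
              forall M : colligation d H U Y,
                dcfm_colligation S M <-> contractive_extension V M),
           (exists M : colligation d H U Y, dcfm_colligation S M) &
           (forall M : colligation d H U Y, dcfm_colligation S M ->
              [/\ weakly_isometric M, controllable M &
                  forall z, S z = charfun M z])]) /\
  (forall (X : hilbertType R) (N : colligation d X U Y),
     controllable N -> weakly_isometric N -> (forall z, charfun N z = S z) ->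
     [/\ positive_kernel (col_kernel N),
         kernel_decomposition S (col_kernel N) &
         forall H : rkhs (col_kernel N),
           exists M : colligation d H U Y,
             dcfm_colligation S M /\ unitarily_equivalent N M]).
Proof.
split=> [Phi Phi_pos dec|X N Nctrl Niso NS].
  split=> [|H]; first exact: moore_aronszajn.
  split=> [|V VV M||M MS].
  - exact: is_Vtilde_ex.
  - exact: dcfm_contractive_extension.
  - exact: dcfm_ex.
  split; first exact: dcfm_weakly_isometric dec _ MS.
  - exact: dcfm_controllable MS.
  - exact: dcfm_charfun MS.
have [Nc _] := Niso; have {NS} <- : charfun N = S by apply/funext.
split=> [||H]; first exact: col_kernel_positive.
- exact: col_kernel_decomposition.
- exact: model_realization.
Qed.
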